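(* Let $\mathbb{F}$ be a field. Up to isomorphism there is a unique nilpotent symplectic alternating algebra $L$ over $\mathbb{F}$ of dimension $10$ with an isotropic centre of dimension $3$ and where $\dim L^{3}=6$ that has the further properties that $L^{3}L^{2}\neq L^{5}$ and $\dim U Z_{4}(L)=2$, where $U=\{x\in L^{3}:\ xL^{2}\leq L^{3}L^{2}\cap L^{5}\}$. This algebra is given by the presentation $$\mathcal{P}_{10}^{(3,5)}:\ (x_{1}y_{2},y_{5})=1,\ (y_{1}y_{2},y_{3})=1,\ (x_{1}y_{3},y_{4})=1,\ (x_{2}y_{4},y_{5})=1.$$
   Context: A symplectic alternating algebra (SAA) over a field $\mathbb{F}$ is a finite-dimensional $\mathbb{F}$-vector space $L$ with a non-degenerate alternating bilinear form $(\ ,\ )$ and a bilinear alternating product $L\times L\to L$, $(x,y)\mapsto xy$ (so $xx=0$), such that $(xy,z)=(yz,x)$ for all $x,y,z\in L$. It follows that $(x,y,z)\mapsto (xy,z)$ is an alternating trilinear form. Isomorphisms of SAAs are linear bijections preserving the form and the product. For subspaces $A,B$, $AB$ denotes the linear span of all products $ab$ with $a\in A,b\in B$. The lower central series is $L^1=L$, $L^{k+1}=L^k L$; the upper central series is $Z_0(L)=0$, $Z_{k+1}(L)=\{x\in L: xL\leq Z_k(L)\}$, with $Z(L)=Z_1(L)$ the centre. $L$ is nilpotent if $L^{k}=0$ for some $k$. A subspace is isotropic if the form vanishes identically on it. A standard basis of a $10$-dimensional SAA is a basis $x_1,y_1,\ldots,x_5,y_5$ with $(x_i,x_j)=(y_i,y_j)=0$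 and $(x_i,y_j)=\delta_{ij}$ for all $i,j$. A presentation lists values of triples $(uv,w)$ with $u,v,w$ distinct elements of a standard basis; the convention is that all triple values of basis elements not listed (and not determined from the listed ones by the alternating property) are $0$. Such data determine the product, hence the SAA, uniquely. *)

(* Defs.v *)
From HB Require Import structures.
From mathcomp Require Import all_boot all_order all_algebra.

Set Implicit Arguments.
Unset Strict Implicit.
Unset Printing Implicit Defensive.

Import GRing.Theory.
Local Open Scope ring_scope.

Record saa (F : fieldType) := SAA {
  saa_sort :> vectType F;
  saa_form : {biscalar saa_sort};
  saa_mul : {bilinear saa_sort -> saa_sort -> saa_sort};
  saa_form_alt : forall x, saa_form x x = 0;
  saa_form_nondeg : forall x, (forall y, saa_form x y = 0) -> x = 0;
  saa_mul_alt : forall x, saa_mul x x = 0;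
  saa_cyclic : forall x y z, saa_form (saa_mul x y) z = saa_form (saa_mul y z) x
}.

Section Theory.
Variables (F : fieldType) (L : saa F).
Implicit Types (A B C : {vspace L}) (x y : L).

(* As in falgebra, products of basis vectors suffice to span A B; see mulvP
   for the independence of the bases. *)
Definition mulv A B : {vspace L} :=
  <<[seq saa_mul L a b | a <- vbasis A, b <- vbasis B]>>%VS.

Lemma memv_mulv A B x y : x \in A -> y \in B -> saa_mul L x y \in mulv A B.
Proof.
move=> /coord_vbasis-> /coord_vbasis->.
rewrite linear_sumlz; apply: memv_suml => i _.
rewrite linear_sumr; apply: memv_suml => j _.
rewrite linearZl_LR linearZr_LR; do 2!apply: memvZ; apply: memv_span.
by apply/allpairsP; exists ((vbasis A)`_i, (vbasis B)`_j);
  split; rewrite // mem_nth ?size_tuple.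
Qed.

Lemma mulvP A B C :
  reflect (forall x y, x \in A -> y \in B -> saa_mul L x y \in C)
          (mulv A B <= C)%VS.
Proof.
apply: (iffP idP) => [/subvP sABC x y Ax By | ABC].
  exact/sABC/memv_mulv.
apply/span_subvP=> _ /allpairsP[[a b] /= [Aa Bb ->]].
by apply: ABC; apply: vbasis_mem.
Qed.

(* The subspace {x in A | x B <= C}; see mem_transporter. *)
Definition transporter A B C : {vspace L} :=
  (A :&: \bigcap_(b <- vbasis B) (linfun (applyr (saa_mul L) b) @^-1: C))%VS.

Lemma mem_transporter A B C x :
  (x \in transporter A B C) = (x \in A) && (mulv <[x]> B <= C)%VS.
Proof.
rewrite memv_cap; congr (_ && _).
have -> : (x \in (\bigcap_(b <- vbasis B)
              (linfun (applyr (saa_mul L) b) @^-1: C))%VS)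
          = all (fun b => saa_mul L x b \in C) (vbasis B).
  elim: (tval (vbasis B)) => [|b s IHs]; first by rewrite big_nil memvf.
  by rewrite big_cons memv_cap IHs -memv_preim lfunE.
apply/allP/mulvP => [xB _ y /vlineP[k ->] /coord_vbasis-> | xBC b Bb].
  rewrite linear_sumr; apply: memv_suml => j _.
  rewrite linearZl_LR linearZr_LR; do 2!apply: memvZ.
  by apply: xB; rewrite mem_nth ?size_tuple.
by apply: xBC; [apply: memv_line | apply: vbasis_mem].
Qed.

(* lcs k is L^k, indexed from L^1 = L; the index 0 is junk (lcs 0 = L). *)
Definition lcs (k : nat) : {vspace L} := iter k.-1 (mulv ^~ fullv) fullv.

Definition ucs (k : nat) : {vspace L} := iter k (transporter fullv fullv) 0%VS.

Definition center : {vspace L} := ucs 1.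

Definition nilpotent : Prop := exists k, lcs k = 0%VS.

Definition isotropic A : Prop := forall x y, x \in A -> y \in A -> saa_form L x y = 0.

End Theory.

Arguments lcs {F} L k.
Arguments ucs {F} L k.
Arguments center {F} L.
Arguments nilpotent {F} L.

Definition isomorphic (F : fieldType) (L1 L2 : saa F) : Prop :=
  exists f : 'Hom(L1, L2), [/\ bijective f,
    forall x y, saa_form L2 (f x) (f y) = saa_form L1 x y &
    forall x y, f (saa_mul L1 x y) = saa_mul L2 (f x) (f y)].

(* A standard basis is indexed by 'I_n + 'I_n, where inl i stands for x_(i+1)
   and inr i for y_(i+1). *)
Definition standard_basis (F : fieldType) (L : saa F) (n : nat)
    (b : 'I_n + 'I_n -> L) : Prop :=
  [/\ basis_of fullv (codom b),
      forall i j, saa_form L (b (inl i)) (b (inl j)) = 0,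
      forall i j, saa_form L (b (inr i)) (b (inr j)) = 0 &
      forall i j, saa_form L (b (inl i)) (b (inr j)) = (i == j)%:R].

(* A presentation is the list of the triples (u, v, w) of basis labels for
   which (uv, w) = 1; the value on a triple that is not a permutation of a
   listed one is 0. *)
Definition presented (F : fieldType) (L : saa F) (n : nat)
    (P : seq (('I_n + 'I_n) * ('I_n + 'I_n) * ('I_n + 'I_n))) : Prop :=
  exists b : 'I_n + 'I_n -> L, [/\ standard_basis b,
    forall u v w, (u, v, w) \in P -> saa_form L (saa_mul L (b u) (b v)) (b w) = 1 &
    forall u v w, ~~ has (fun t => perm_eq [:: u; v; w] [:: t.1.1; t.1.2; t.2]) P ->
      saa_form L (saa_mul L (b u) (b v)) (b w) = 0].

Definition P_10_3_5 : seq (('I_5 + 'I_5) * ('I_5 + 'I_5) * ('I_5 + 'I_5)) :=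
  let x (i : nat) := inl (inord i.-1) in
  let y (i : nat) := inr (inord i.-1) in
  [:: (x 1, y 2, y 5); (y 1, y 2, y 3); (x 1, y 3, y 4); (x 2, y 4, y 5)]%N.

Definition Usub (F : fieldType) (L : saa F) : {vspace L} :=
  transporter (lcs L 3) (lcs L 2) (mulv (lcs L 3) (lcs L 2) :&: lcs L 5)%VS.

Definition has_invariants_10_3_5 (F : fieldType) (L : saa F) : Prop :=
  [/\ nilpotent L, \dim {:L} = 10,
      isotropic (center L) /\ \dim (center L) = 3 &
      [/\ \dim (lcs L 3) = 6,
          mulv (lcs L 3) (lcs L 2) <> lcs L 5 &
          \dim (mulv (Usub L) (ucs L 4)) = 2]]%N.

(* Main.v *)
Require Import Defs.
From HB Require Import structures.
From mathcomp Require Import all_boot all_order all_algebra.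
From mathcomp Require Import ring zify.

Set Implicit Arguments.
Unset Strict Implicit.
Unset Printing Implicit Defensive.

Import GRing.Theory.
Local Open Scope ring_scope.

(** Write t(x, y, z) = (xy, z), an alternating trilinear form whose radical is the
  centre Z, and recall that Z_k is the orthogonal of L^(k+1) ([ucsE]).

  Structure.  The dimensions and nilpotency give Z < Z_2 < L^3 < L^2, with
  dimensions 3, 4, 6, 7.  The crucial point is the symplectic plane L^3 / Z_2: each
  v acts on it by an endomorphism for which (xv, y) is alternating in x and y, and in
  dimension 2 such an endomorphism is a scalar, hence 0 because L is nilpotent.
  Thus t(L^3, L^3, L) = 0 ([mulL3L3]); consequently L^3 L^2 <= Z and L^4 <= Z_2.
  Choose x_2 in Z_2 and y_2 in L^2 with (x_2, y_2) = 1.  What is left of t consists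
  of three 2-forms on L / L^3, attached to x_2 and to a basis x_1, y_1 of L^3 / Z_2,
  and of the values of t on a complement of L^3.

  Normal form.  On the 3-dimensional space L / L^2 the 2-form (x_2 _, _) has a
  one-dimensional radical, spanned by y_3; L^5 = x_2 L is the plane of Z orthogonal
  to it.  The plane L^3 L^2 of Z is spanned by x_1 y_2 and y_1 y_2.  As the two
  planes differ, their intersection is a line, which singles out x_1 up to a scalar
  modulo Z_2, and y_1, y_4, y_5 can be chosen so that y_3, y_5 are dual to y_1 y_2,
  x_1 y_2 ([frame_exists]).  Then U = Z_2 + <x_1> and Z_4 = L^2 + <y_3>, so
  U Z_4 = <x_1 y_2, x_1 y_3>, and dim U Z_4 = 2 says that (x_1 y_3, y_4) is not 0
  ([frame_x134]).  Four explicit changes of basis scale this value to 1 and remove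
  all coordinates that are not in the presentation ([normal_frame_exists]).  These
  changes are made modulo Z, which t ignores; a final correction by central vectors
  makes the basis standard ([presented_mod_center]).

  A presentation determines its algebra up to isomorphism
  ([presented_isomorphic]), which proves uniqueness.  For existence, an algebra with
  the given presentation is built on coordinate vectors ([model_presented]); all
  terms of its two central series are spanned by basis vectors, so its invariants
  are found by a finite computation on indices ([presented_invariants]). *)

(** * The calculus of the form and the product *)

Local Notation "''[' x , y ]" := (saa_form _ x y) (at level 0, format "''[' x ,  y ]") : ring_scope.
Notation "x ** y" := (saa_mul _ x y) (at level 40, left associativity) : ring_scope.

Section Calculus.
Variables (F : fieldType) (L : saa F).
Implicit Types (x y z : L) (k : F).

Lemma formDl x y z : '[x + y, z] = '[x, z] + '[y, z].
Proof. exact: linearDl. Qed.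
Lemma formDr x y z : '[z, x + y] = '[z, x] + '[z, y].
Proof. exact: linearDr. Qed.
Lemma formNl x z : '[- x, z] = - '[x, z].
Proof. exact: linearNl. Qed.
Lemma formNr x z : '[z, - x] = - '[z, x].
Proof. exact: linearNr. Qed.
Lemma formZl k x z : '[k *: x, z] = k * '[x, z].
Proof. exact: linearZl_LR. Qed.
Lemma formZr k x z : '[z, k *: x] = k * '[z, x].
Proof. exact: linearZr_LR. Qed.
Lemma form0l z : '[0, z] = 0 :> F.
Proof. exact: linear0l. Qed.
Lemma form0r z : '[z, 0] = 0 :> F.
Proof. exact: linear0r. Qed.

Definition formE :=
  (formDl, formDr, formNl, formNr, formZl, formZr, form0l, form0r).

Lemma form_anti x y : '[x, y] = - '[y, x].
Proof.
have := saa_form_alt (x + y); rewrite !formE !saa_form_alt add0r addr0.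
by move/eqP; rewrite addr_eq0 => /eqP.
Qed.

Lemma mulDl x y z : (x + y) ** z = x ** z + y ** z.
Proof. exact: linearDl. Qed.
Lemma mulDr x y z : z ** (x + y) = z ** x + z ** y.
Proof. exact: linearDr. Qed.
Lemma mulNl x z : (- x) ** z = - (x ** z).
Proof. exact: linearNl. Qed.
Lemma mulNr x z : z ** (- x) = - (z ** x).
Proof. exact: linearNr. Qed.
Lemma mulZl k x z : (k *: x) ** z = k *: (x ** z).
Proof. exact: linearZl_LR. Qed.
Lemma mulZr k x z : z ** (k *: x) = k *: (z ** x).
Proof. exact: linearZr_LR. Qed.
Lemma saa_mul0l z : 0 ** z = 0 :> L.
Proof. exact: linear0l. Qed.
Lemma saa_mul0r z : z ** 0 = 0 :> L.
Proof. exact: linear0r. Qed.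

Definition mulE := (mulDl, mulDr, mulNl, mulNr, mulZl, mulZr, saa_mul0l, saa_mul0r).

Lemma mul_anti x y : x ** y = - (y ** x).
Proof.
have := saa_mul_alt (x + y); rewrite !mulE !saa_mul_alt add0r addr0.
by move/eqP; rewrite addr_eq0 => /eqP.
Qed.

Lemma tri_rot x y z : '[x ** y, z] = '[y ** z, x].
Proof. exact: saa_cyclic. Qed.

Lemma tri_swap12 x y z : '[x ** y, z] = - '[y ** x, z].
Proof. by rewrite mul_anti formE. Qed.

Lemma tri_swap23 x y z : '[x ** y, z] = - '[x ** z, y].
Proof. by rewrite tri_rot tri_swap12 tri_rot tri_rot. Qed.

Lemma tri_xxz x z : '[x ** x, z] = 0.
Proof. by rewrite saa_mul_alt formE. Qed.
Lemma tri_xyy x y : '[x ** y, y] = 0.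
Proof. by rewrite tri_rot tri_xxz. Qed.
Lemma tri_xyx x y : '[x ** y, x] = 0.
Proof. by rewrite tri_rot tri_xyy. Qed.

Definition tri_alt := (tri_xxz, tri_xyy, tri_xyx).

(** Packed as one rewriting rule, so that a value known for one order of the
  arguments is recognized in every order. *)
Lemma tri_perms x y z (c : F) : '[x ** y, z] = c ->
  ('[x ** y, z] = c) * ('[y ** z, x] = c) * ('[z ** x, y] = c) *
  ('[y ** x, z] = - c) * ('[x ** z, y] = - c) * ('[z ** y, x] = - c).
Proof.
move=> <-; rewrite -[LHS]/('[x ** y, z]).
have E : '[y ** z, x] = '[x ** y, z] by rewrite -tri_rot.
have E2 : '[z ** x, y] = '[x ** y, z] by rewrite tri_rot.
by rewrite (tri_swap12 y x) (tri_swap12 x z) (tri_swap12 z y) E E2.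
Qed.

(** Packed as one rewriting rule: a triple containing two elements of product 0 is
  annihilated by the trilinear form whatever the order of its arguments. *)
Lemma tri_kill x y : x ** y = 0 ->
  (x ** y = 0) * (y ** x = 0) *
  (forall z, '[x ** z, y] = 0) * (forall z, '[z ** x, y] = 0) *
  (forall z, '[y ** z, x] = 0) * (forall z, '[z ** y, x] = 0).
Proof.
move=> xy; have yx : y ** x = 0 by rewrite mul_anti xy oppr0.
have K z : '[x ** y, z] = 0 by rewrite xy form0l.
by do 5?[split] => //; move=> z; rewrite (tri_perms (K z)) ?oppr0.
Qed.

End Calculus.

(** * Orthogonal subspaces and the central series *)

Section Orthogonal.
Variables (F : fieldType) (L : saa F).
Implicit Types (A B C : {vspace L}) (x y z : L).

Definition pairings n (t : n.-tuple L) x : 'rV[F]_n := \row_i '[x, t`_i].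

Fact pairings_linear n (t : n.-tuple L) : linear (pairings t).
Proof. by move=> k u v; apply/rowP=> j; rewrite !mxE !formE. Qed.

HB.instance Definition _ n (t : n.-tuple L) :=
  GRing.isLinear.Build F L 'rV[F]_n _ (pairings t) (pairings_linear t).

Definition orth A : {vspace L} := lker (linfun (pairings (vbasis A))).

Lemma pairings_eq0P A x :
  reflect (forall y, y \in A -> '[x, y] = 0) (pairings (vbasis A) x == 0).
Proof.
apply: (iffP eqP) => [/rowP x0 y /coord_vbasis-> | x0].
  rewrite linear_sumr big1 // => i _; rewrite linearZr_LR /=.
  by have := x0 i; rewrite !mxE => ->; rewrite mulr0.
apply/rowP=> i; rewrite !mxE x0 //; apply: vbasis_mem.
by rewrite mem_nth ?size_tuple.
Qed.

Lemma orthP A x : reflect (forall y, y \in A -> '[x, y] = 0) (x \in orth A).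
Proof. by rewrite memv_ker lfunE; apply: pairings_eq0P. Qed.

(** Pairing with a basis of A has kernel [orth A] and at most [\dim A]
  coordinates.  Conversely A pairs faithfully with any complement of its
  orthogonal, because a vector of A orthogonal to that complement is orthogonal
  to everything. *)
Lemma dim_orth A : (\dim A + \dim (orth A) = \dim {:L})%N.
Proof.
apply/eqP; rewrite eqn_leq; apply/andP; split.
  pose C := (orth A)^C%VS; pose f := linfun (pairings (vbasis C)).
  have injf : (A :&: lker f)%VS = 0%VS.
    apply/eqP; rewrite -subv0; apply/subvP=> x; rewrite memv_cap memv0.
    case/andP=> Ax /orthP Cx; apply/eqP/saa_form_nondeg => y.
    have : y \in (orth A + C)%VS by rewrite addv_complf memvf.
    case/memv_addP=> u /orthP Au [v Cv ->].
    by rewrite formE (Cx v) // form_anti Au // oppr0 add0r.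
  have := dimvS (subvf (f @: A)%VS); rewrite (limg_dim_eq injf).
  rewrite dimvf /dim /= mul1n dimv_compl => leA.
  rewrite addnC; apply: leq_trans (leq_add (leqnn _) leA) _.
  by rewrite subnKC ?dimvS ?subvf.
rewrite -(limg_ker_dim (linfun (pairings (vbasis A))) fullv) capfv addnC.
rewrite leq_add2r; apply: leq_trans (dimvS (subvf _)) _.
by rewrite dimvf /dim /= mul1n.
Qed.

Lemma orthS A B : (A <= B)%VS -> (orth B <= orth A)%VS.
Proof.
by move=> /subvP sAB; apply/subvP=> x /orthP Bx; apply/orthP=> y /sAB/Bx.
Qed.

Lemma orthK A : orth (orth A) = A.
Proof.
apply/esym/eqP; rewrite eqEdim -(leq_add2l (\dim (orth A))) dim_orth.
rewrite addnC dim_orth leqnn andbT; apply/subvP=> x Ax; apply/orthP=> y /orthP Ay.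
by rewrite form_anti Ay ?oppr0.
Qed.

Lemma not_orth A x : x \notin orth A -> exists2 y, y \in A & '[x, y] = 1.
Proof.
rewrite memv_ker lfunE /= => /eqP nz.
have [i xi] : exists i : 'I_(\dim A), '[x, (vbasis A)`_i] != 0.
  case: (pickP (fun i : 'I_(\dim A) => '[x, (vbasis A)`_i] != 0)) => [i xi|x0].
    by exists i.
  by case: nz; apply/rowP=> i; rewrite !mxE; apply/eqP/negbFE/x0.
exists ('[x, (vbasis A)`_i]^-1 *: (vbasis A)`_i); last by rewrite formE mulVf.
by apply: memvZ; apply: vbasis_mem; rewrite mem_nth ?size_tuple.
Qed.

Lemma lcsS k : lcs L k.+2 = mulv (lcs L k.+1) fullv. Proof. by []. Qed.

(** Since (xv, a) = (va, x), the products xv are orthogonal to L^k exactly when x is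
  orthogonal to L^(k+1). *)
Lemma ucsE k : ucs L k = orth (lcs L k.+1).
Proof.
elim: k => [|k IHk].
  apply/esym/eqP; rewrite -subv0; apply/subvP=> x /orthP x0.
  by rewrite memv0; apply/eqP/saa_form_nondeg=> y; apply: x0; rewrite memvf.
have -> : ucs L k.+1 = transporter fullv fullv (ucs L k) by [].
apply/vspaceP=> x; rewrite mem_transporter memvf /= IHk.
apply/mulvP/orthP => [xL y | x0 y v /vlineP[c ->] _].
  rewrite lcsS; have : (mulv (lcs L k.+1) fullv <= orth <[x]>)%VS.
    apply/mulvP=> a v Aa _; apply/orthP=> _ /vlineP[c ->]; rewrite formE.
    have /orthP/(_ a Aa) := xL x v (memv_line x) (memvf v).
    by move/tri_perms=> E; rewrite E oppr0 mulr0.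
  by move/subvP=> sub /sub/orthP/(_ x (memv_line x)) E; rewrite form_anti E oppr0.
apply/orthP=> a Aa; rewrite !mulE formE tri_rot form_anti x0 ?oppr0 ?mulr0 //.
by rewrite lcsS mul_anti memvN memv_mulv ?memvf.
Qed.

End Orthogonal.

(** * Subspaces enlarged by one vector, and nilpotency *)

Section Subspaces.
Variables (F : fieldType) (V : vectType F).
Implicit Types (A B U : {vspace V}) (v : V).

Lemma dim_add_line U v : v \notin U -> \dim (U + <[v]>) = (\dim U).+1.
Proof.
move=> Uv; have nz : v != 0 by apply: contraNneq Uv => ->; rewrite mem0v.
rewrite dimv_disjoint_sum; first by rewrite dim_vline nz addn1.
apply/eqP; rewrite -subv0; apply/subvP=> w; rewrite memv_cap memv0.
case/andP=> Uw /vlineP[c Ew]; move: Uw; rewrite Ew.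
by have [->|c0] := eqVneq c 0; rewrite ?scale0r // rpredZeq (negPf c0) (negPf Uv).
Qed.

Lemma eq_add_line A B v : (A <= B)%VS -> v \in B -> v \notin A ->
  (\dim B <= (\dim A).+1)%N -> B = (A + <[v]>)%VS.
Proof.
move=> sAB Bv Av leB; apply/esym/eqP.
by rewrite eqEdim dim_add_line // leB andbT subv_add sAB -memvE.
Qed.

Lemma mem_add_line U v w : w \in (U + <[v]>)%VS ->
  exists2 u, u \in U & exists c, w = u + c *: v.
Proof. by case/memv_addP=> u Uu [_ /vlineP[c ->] ->]; exists u => //; exists c. Qed.

End Subspaces.

(** Modulo the ideal B, the subspace A is contained in all its iterated products
  with L, which vanish eventually. *)
Lemma nilpotent_sub (F : fieldType) (L : saa F) (A B : {vspace L}) :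
  nilpotent L -> (mulv B fullv <= B)%VS -> (A <= mulv A fullv + B)%VS ->
  (A <= B)%VS.
Proof.
move=> [k Lk] idB sA.
suff sub j : (A <= lcs L j + B)%VS by have := sub k; rewrite Lk add0v.
elim: j => [|[|j] IHj]; try exact: subv_trans (subvf _) (addvSl _ _).
apply: subv_trans sA _; rewrite subv_add addvSr andbT.
apply/mulvP=> a v Aa _; case/memv_addP: (subvP IHj _ Aa) => u Lu [w Bw ->].
rewrite mulE; apply: memv_add; first by apply: memv_mulv; rewrite ?memvf.
by apply: (subvP idB); rewrite memv_mulv ?memvf.
Qed.

(** * Standard bases *)

Section StandardBasis.
Variables (F : fieldType) (L : saa F) (n : nat) (b : 'I_n + 'I_n -> L).

Definition hyperbolic : Prop :=
  [/\ forall i j, '[b (inl i), b (inl j)] = 0,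
      forall i j, '[b (inr i), b (inr j)] = 0 &
      forall i j, '[b (inl i), b (inr j)] = (i == j)%:R].

Definition dual (u : 'I_n + 'I_n) : 'I_n + 'I_n :=
  match u with inl i => inr i | inr i => inl i end.

Definition dual_sign (u : 'I_n + 'I_n) : F := if u is inl _ then 1 else -1.

Lemma dualK : involutive dual. Proof. by case. Qed.

Lemma dual_signK u : dual_sign u * dual_sign u = 1.
Proof. by case: u => i /=; rewrite ?mulrNN mulr1. Qed.

Hypothesis hyp_b : hyperbolic.

Lemma form_dual u v : '[b u, b (dual v)] = (u == v)%:R * dual_sign u.
Proof.
case: hyp_b => xx yy xy; case: u v => i [j|j] /=; rewrite ?mulr1.
- exact: xy.
- exact: xx.
- by rewrite yy mul0r.
by rewrite form_anti xy mulrN1 eq_sym.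
Qed.

(** The coordinate along [b u], read off by pairing with the dual basis vector. *)
Definition hcoord u x : F := dual_sign u * '[x, b (dual u)].

Lemma hcoord_lin u k x y : hcoord u (k *: x + y) = k * hcoord u x + hcoord u y.
Proof. by rewrite /hcoord !formE; ring. Qed.

Lemma hcoord0 u : hcoord u 0 = 0.
Proof. by rewrite /hcoord form0l mulr0. Qed.

Lemma hcoord_sum (I : finType) u (k : I -> F) (f : I -> L) :
  hcoord u (\sum_i k i *: f i) = \sum_i k i * hcoord u (f i).
Proof.
apply: (big_ind2 (fun x c => hcoord u x = c)) => [||i _]; first exact: hcoord0.
  by move=> x c y d xc yd; rewrite -[x]scale1r hcoord_lin mul1r xc yd.
by rewrite -[_ *: _]addr0 hcoord_lin hcoord0 addr0.
Qed.

Lemma hcoord_basis u v : hcoord u (b v) = (u == v)%:R.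
Proof.
rewrite /hcoord form_dual eq_sym; case: eqP => [->|_]; last by rewrite mul0r mulr0.
by rewrite mul1r dual_signK.
Qed.

Lemma hyperbolic_free : free (codom b).
Proof.
apply/(@freeP _ _ _ (codom_tuple b)) => k; rewrite (reindex enum_rank) /=; last first.
  exact: onW_bij (enum_rank_bij _).
under eq_bigr => u _ do rewrite nth_codom enum_rankK.
move=> E i; rewrite -[i]enum_valK; have := congr1 (hcoord (enum_val i)) E.
rewrite hcoord_sum hcoord0 (bigD1 (enum_val i)) //= hcoord_basis eqxx mulr1.
rewrite big1 ?addr0 // => u /negPf ui.
by rewrite hcoord_basis eq_sym ui mulr0.
Qed.

Lemma hyperbolic_standard : \dim {:L} = (n + n)%N -> standard_basis b.
Proof.
case: (hyp_b) => xx yy xy dimL; split=> //.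
have sz : size (codom b) = (n + n)%N by rewrite size_codom card_sum card_ord.
rewrite basisEfree hyperbolic_free /=; apply/andP; split; last by rewrite sz dimL.
exact: subvf.
Qed.

End StandardBasis.

Section StandardTheory.
Variables (F : fieldType) (L : saa F) (n : nat) (b : 'I_n + 'I_n -> L).
Hypothesis std_b : standard_basis b.

Lemma standard_hyperbolic : hyperbolic b. Proof. by case: std_b. Qed.
Let hb := standard_hyperbolic.

Lemma standard_ind (P : L -> Prop) :
  P 0 -> (forall k x y, P x -> P y -> P (k *: x + y)) -> (forall u, P (b u)) ->
  forall x, P x.
Proof.
move=> P0 Plin Pb x; case: std_b => /andP[/eqP span_b _] _ _ _.
have: x \in <<codom b>>%VS by rewrite span_b memvf.
move=> /coord_span->; apply: (big_ind P) => [||i _] //.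
  by move=> u v Pu Pv; rewrite -[u]scale1r; apply: Plin.
rewrite -[_ *: _]addr0; apply: Plin => //.
have /codomP[u ->] : (codom b)`_i \in codom b by rewrite mem_nth ?size_codom.
exact: Pb.
Qed.

Lemma standard_expand x : x = \sum_u hcoord b u x *: b u.
Proof.
apply: (standard_ind (P := fun x => x = \sum_u hcoord b u x *: b u)) => [|k y z|v].
- by rewrite big1 // => u _; rewrite hcoord0 scale0r.
- move=> {1}-> {1}->; rewrite scaler_sumr -big_split; apply: eq_bigr => u _.
  by rewrite hcoord_lin scalerDl scalerA.
rewrite (bigD1 v) //= hcoord_basis // eqxx scale1r big1 ?addr0 // => u /negPf uv.
by rewrite hcoord_basis // uv scale0r.
Qed.

Lemma standard_eq x y : (forall u, '[x, b u] = '[y, b u]) -> x = y.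
Proof.
move=> xy; rewrite (standard_expand x) (standard_expand y).
by apply: eq_bigr => u _; rewrite /hcoord xy.
Qed.

Lemma dim_standard : \dim {:L} = (n + n)%N.
Proof.
case: std_b => /andP[/eqP <- /eqP-> _ _ _].
by rewrite size_codom card_sum card_ord.
Qed.

End StandardTheory.

(** * A presentation determines the algebra *)

Section Determined.
Variables (F : fieldType) (n : nat).
Implicit Types (L : saa F).

Definition standard_map L1 L2 (b1 : 'I_n + 'I_n -> L1) (b2 : 'I_n + 'I_n -> L2) x : L2 :=
  \sum_u hcoord b1 u x *: b2 u.

Fact standard_map_linear L1 L2 (b1 : 'I_n + 'I_n -> L1) (b2 : 'I_n + 'I_n -> L2) :
  linear (standard_map b1 b2).
Proof.
move=> k x y; rewrite /standard_map scaler_sumr -big_split; apply: eq_bigr => u _.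
by rewrite hcoord_lin scalerDl scalerA.
Qed.

HB.instance Definition _ L1 L2 (b1 : 'I_n + 'I_n -> L1) (b2 : 'I_n + 'I_n -> L2) :=
  GRing.isLinear.Build F L1 L2 _ (standard_map b1 b2) (standard_map_linear b1 b2).

Lemma standard_mapE L1 L2 (b1 : 'I_n + 'I_n -> L1) (b2 : 'I_n + 'I_n -> L2) u :
  hyperbolic b1 -> standard_map b1 b2 (b1 u) = b2 u.
Proof.
move=> hb; rewrite /standard_map (bigD1 u) //= hcoord_basis // eqxx scale1r.
rewrite big1 ?addr0 // => v /negPf vu; by rewrite hcoord_basis // vu scale0r.
Qed.

Lemma standard_mapK L1 L2 (b1 : 'I_n + 'I_n -> L1) (b2 : 'I_n + 'I_n -> L2) :
  standard_basis b1 -> standard_basis b2 ->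
  cancel (standard_map b1 b2) (standard_map b2 b1).
Proof.
move=> s1 s2; have h1 := standard_hyperbolic s1; have h2 := standard_hyperbolic s2.
apply: (standard_ind s1) => [|k x y Ex Ey|u]; first by rewrite !linear0.
  by rewrite !linearP /= Ex Ey.
by rewrite !standard_mapE.
Qed.

Lemma standard_isomorphic L1 L2 (b1 : 'I_n + 'I_n -> L1) (b2 : 'I_n + 'I_n -> L2) :
  standard_basis b1 -> standard_basis b2 ->
  (forall u v w, '[b1 u ** b1 v, b1 w] = '[b2 u ** b2 v, b2 w]) ->
  isomorphic L1 L2.
Proof.
move=> s1 s2 eq_tri; pose f : {linear L1 -> L2} := standard_map b1 b2.
have h1 := standard_hyperbolic s1; have h2 := standard_hyperbolic s2.
have fE u : f (b1 u) = b2 u by apply: standard_mapE.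
have f_form x y : '[f x, f y] = '[x, y].
  move: x; apply: (standard_ind s1) => [|k x x' Ex Ex'|u].
  - by rewrite linear0 !form0l.
  - by rewrite linearP /= !formE Ex Ex'.
  move: y; apply: (standard_ind s1) => [|k y y' Ey Ey'|v].
  - by rewrite linear0 !form0r.
  - by rewrite linearP /= !formE Ey Ey'.
  by rewrite !fE -[v]dualK !form_dual.
exists (linfun f); split.
- exists (standard_map b2 b1) => x; rewrite lfunE; exact: standard_mapK.
- by move=> x y; rewrite !lfunE f_form.
move=> x y; rewrite !lfunE /=.
move: x; apply: (standard_ind s1) => [|k x x' Ex Ex'|u].
- by rewrite !(saa_mul0l, linear0).
- by rewrite !(linearP, mulE) /= Ex Ex'.
move: y; apply: (standard_ind s1) => [|k y y' Ey Ey'|v].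
- by rewrite !(saa_mul0r, linear0).
- by rewrite !(linearP, mulE) /= Ey Ey'.
apply: (standard_eq s2) => w.
by rewrite -{1}fE f_form eq_tri !fE.
Qed.

Lemma perm_eq2 (T : eqType) (u v p q : T) : perm_eq [:: u; v] [:: p; q] ->
  (u = p /\ v = q) \/ (u = q /\ v = p).
Proof.
move=> E; have := perm_mem E u; rewrite !inE eqxx /= => /esym/orP[]/eqP eu.
  by left; move: E; rewrite eu perm_cons => /(perm_mem)/(_ v);
    rewrite !inE eqxx => /esym/eqP.
right; move: E; rewrite eu (perm_sym _ [:: p; q]) (perm_catC [:: p] [:: q]) perm_cons.
by move=> /perm_mem/(_ p); rewrite !inE eqxx => /esym/eqP.
Qed.

(** Both trilinear forms are alternating, so they change by the same sign when a
  triple is permuted. *)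
Lemma tri_perm_eq L1 L2 (b1 : 'I_n + 'I_n -> L1) (b2 : 'I_n + 'I_n -> L2) u v w p q r c :
  perm_eq [:: u; v; w] [:: p; q; r] ->
  '[b1 p ** b1 q, b1 r] = c -> '[b2 p ** b2 q, b2 r] = c ->
  '[b1 u ** b1 v, b1 w] = '[b2 u ** b2 v, b2 w].
Proof.
move=> E /tri_perms E1 /tri_perms E2.
have := perm_mem E p; rewrite !inE eqxx /= => /or3P[]/eqP ep; move: E; rewrite -ep.
- rewrite perm_cons => /perm_eq2[][-> ->]; by rewrite E1 E2.
- rewrite (perm_catCA [:: u] [:: p] [:: w]) perm_cons => /perm_eq2[][-> ->].
    by rewrite E1 E2.
  by rewrite E1 E2.
rewrite (perm_catC [:: u; v] [:: p]) perm_cons => /perm_eq2[][-> ->].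
  by rewrite E1 E2.
by rewrite E1 E2.
Qed.

Lemma presented_isomorphic L1 L2
    (P : seq (('I_n + 'I_n) * ('I_n + 'I_n) * ('I_n + 'I_n))) :
  presented L1 P -> presented L2 P -> isomorphic L1 L2.
Proof.
move=> [b1 [s1 one1 zero1]] [b2 [s2 one2 zero2]].
apply: (standard_isomorphic s1 s2) => u v w.
case: (boolP (has (fun t => perm_eq [:: u; v; w] [:: t.1.1; t.1.2; t.2]) P)); last first.
  by move=> nP; rewrite zero1 ?zero2.
by case/hasP=> -[[p q] r] Pt /= E; apply: tri_perm_eq E (one1 _ _ _ Pt) (one2 _ _ _ Pt).
Qed.

End Determined.

(** * Numerical codes for the basis labels *)

(** Coding labels by numbers makes membership of a triple in the presentation
  decidable by computation: 0, ..., 4 stand for the x_i and 5, ..., 9 for the y_i. *)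
Definition code (u : 'I_5 + 'I_5) : nat :=
  match u with inl i => i | inr i => (5 + i)%N end.

Definition decode (k : nat) : 'I_5 + 'I_5 :=
  if (k < 5)%N then inl (inord k) else inr (inord (k - 5)).

Definition codual (k : nat) : nat := if (k < 5)%N then (k + 5)%N else (k - 5)%N.

Definition code_triples : seq (seq nat) :=
  [:: [:: 0; 6; 9]; [:: 5; 6; 7]; [:: 0; 7; 8]; [:: 1; 8; 9]]%N.

Definition listed (i j k : nat) : bool := has (perm_eq [:: i; j; k]) code_triples.

Lemma code_lt u : (code u < 10)%N.
Proof. by case: u => i /=; have := ltn_ord i; lia. Qed.

Lemma codeK : cancel code decode.
Proof.
case=> i; rewrite /decode /=; first by rewrite ltn_ord inord_val.
by rewrite addKn inord_val.
Qed.

Lemma decodeK k : (k < 10)%N -> code (decode k) = k.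
Proof. by rewrite /decode => lt_k; case: ltnP => k5 /=; rewrite inordK; lia. Qed.

Lemma decode_dual k : (k < 10)%N -> dual (decode k) = decode (codual k).
Proof.
rewrite /decode /codual => lt_k; case: ltnP => k5 /=.
  by rewrite ltnNge leq_addl /= addnK.
by rewrite ifT //; lia.
Qed.

Lemma code_P_10_3_5 :
  [seq [:: code t.1.1; code t.1.2; code t.2] | t <- P_10_3_5] = code_triples.
Proof. by rewrite /= !inordK. Qed.

Lemma listedE u v w :
  has (fun t => perm_eq [:: u; v; w] [:: t.1.1; t.1.2; t.2]) P_10_3_5 =
  listed (code u) (code v) (code w).
Proof.
rewrite /listed -code_P_10_3_5 has_map; apply: eq_has => t /=.
have E s1 s2 : perm_eq s1 s2 = perm_eq (map code s1) (map code s2).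
  by apply/idP/idP; [apply: perm_map | apply/perm_map_inj/can_inj/codeK].
exact: (E [:: u; v; w] [:: t.1.1; t.1.2; t.2]).
Qed.

Lemma listed_perm i j k i' j' k' : perm_eq [:: i; j; k] [:: i'; j'; k'] ->
  listed i j k = listed i' j' k'.
Proof. by move=> E; apply: eq_has => t; apply: (permPl E). Qed.

Section Codes.
Variables (F : fieldType) (L : saa F).

(** Being listed is invariant under permutations, and vanishing of an alternating
  form is too, so increasing triples suffice. *)
Lemma tri_zero_sorted (e : nat -> L) :
  (forall i j k, (i < j < k)%N -> (k < 10)%N -> ~~ listed i j k ->
    '[e i ** e j, e k] = 0) ->
  forall i j k, (i < 10)%N -> (j < 10)%N -> (k < 10)%N -> ~~ listed i j k ->
    '[e i ** e j, e k] = 0.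
Proof.
move=> H.
have H1 i j k : (i < j)%N -> (j < 10)%N -> (k < 10)%N -> ~~ listed i j k ->
    '[e i ** e j, e k] = 0.
  move=> ij j10 k10 nl; case: (ltngtP j k) => [jk|kj|<-]; last exact: tri_xyy.
    by rewrite H ?ij.
  rewrite tri_swap23; case: (ltngtP i k) => [ik|ki|<-]; last by rewrite tri_xxz oppr0.
    rewrite H ?ik ?oppr0 // (@listed_perm _ _ _ i j k) //.
    by rewrite perm_cons (perm_catC [:: k] [:: j]).
  rewrite tri_swap12 H ?ki ?oppr0 // (@listed_perm _ _ _ i j k) //.
  by rewrite (perm_catC [:: k] [:: i; j]).
move=> i j k i10 j10 k10 nl; case: (ltngtP i j) => [ij|ji|<-]; last exact: tri_xxz.
  exact: H1.
rewrite tri_swap12 H1 ?oppr0 // (@listed_perm _ _ _ i j k) //.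
by rewrite (perm_catCA [:: j] [:: i] [:: k]).
Qed.

Lemma presented_codes (e : nat -> L) : \dim {:L} = 10%N ->
  (forall i j, (i < 5)%N -> (j < 5)%N -> [/\ '[e i, e j] = 0,
     '[e (5 + i)%N, e (5 + j)%N] = 0 & '[e i, e (5 + j)%N] = (i == j)%:R]) ->
  (forall i j k, (i < j < k)%N -> (k < 10)%N -> ~~ listed i j k ->
    '[e i ** e j, e k] = 0) ->
  all (fun t => '[e t`_0 ** e t`_1, e t`_2] == 1) code_triples ->
  presented L P_10_3_5.
Proof.
move=> dimL He He0 He1; exists (fun u => e (code u)); split.
- apply: hyperbolic_standard => //; split=> i j /=;
  by have [] := He i j (ltn_ord i) (ltn_ord j).
- move=> u v w /(map_f (fun t => [:: code t.1.1; code t.1.2; code t.2])).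
  by rewrite code_P_10_3_5 => /(allP He1)/eqP.
by move=> u v w; rewrite listedE; apply: tri_zero_sorted => //; apply: code_lt.
Qed.

End Codes.

(** * Invariants of the presented algebra *)

Section Invariants.
Variables (F : fieldType) (L : saa F) (b : 'I_5 + 'I_5 -> L).
Hypotheses (std_b : standard_basis b)
  (oneP : forall u v w, (u, v, w) \in P_10_3_5 -> '[b u ** b v, b w] = 1)
  (zeroP : forall u v w,
    ~~ has (fun t => perm_eq [:: u; v; w] [:: t.1.1; t.1.2; t.2]) P_10_3_5 ->
    '[b u ** b v, b w] = 0).

Let e k := b (decode k).
Let hyp_b : hyperbolic b := standard_hyperbolic std_b.

Lemma form_code_eq0 i j : (i < 10)%N -> (j < 10)%N ->
  ('[e i, e (codual j)] == 0) = (i != j).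
Proof.
move=> i10 j10; rewrite /e -decode_dual // form_dual // mulf_eq0.
have -> : (decode i == decode j) = (i == j).
  by rewrite -(can_eq codeK) !decodeK.
case: (i =P j) => _; rewrite ?eqxx // oner_eq0.
by case: (decode i) => ?; rewrite /= ?oppr_eq0 oner_eq0.
Qed.

Lemma tri_code_eq0 i j k : (i < 10)%N -> (j < 10)%N -> (k < 10)%N ->
  ('[e i ** e j, e k] == 0) = ~~ listed i j k.
Proof.
move=> i10 j10 k10; have := listedE (decode i) (decode j) (decode k).
rewrite !decodeK // => <-.
case: (boolP (has _ _)) => [/hasP[[[p q] r] Pt /= E]|/zeroP->]; last exact: eqxx.
apply/negbTE/eqP=> zero; have := oneP Pt.
rewrite perm_sym in E.
rewrite (tri_perm_eq (b2 := fun=> 0 : L) E zero) ?saa_mul0l ?form0l //.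
by move/esym/eqP; rewrite oner_eq0.
Qed.

Lemma codual_lt k : (k < 10)%N -> (codual k < 10)%N.
Proof. by rewrite /codual; case: ifP; lia. Qed.

Lemma codualK k : (k < 10)%N -> codual (codual k) = k.
Proof. by rewrite /codual; case: (ltnP k 5) => k5; case: ifP; lia. Qed.

Definition cspan (s : seq nat) : {vspace L} := <<[seq e k | k <- s]>>.

Lemma mem_cspan_basis s k : k \in s -> e k \in cspan s.
Proof. by move=> sk; apply: memv_span; apply: map_f. Qed.

Lemma cspanP s x : all (ltn^~ 10) s ->
  reflect (forall k, (k < 10)%N -> k \notin s -> '[x, e (codual k)] = 0)
          (x \in cspan s).
Proof.
move=> /allP s10; apply: (iffP idP) => [sx k k10 sk | x0].
  have : (cspan s <= orth <[e (codual k)]>)%VS.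
    apply/span_subvP=> _ /mapP[i si ->]; apply/orthP=> _ /vlineP[c ->].
    apply/eqP; rewrite formE mulf_eq0 form_code_eq0 ?(s10 _ si : (i < 10)%N) //.
    by apply/orP; right; apply: contraNneq sk => <-.
  by move/subvP=> /(_ x sx)/orthP; apply; apply: memv_line.
rewrite (standard_expand std_b x); apply: memv_suml => u _.
have [su|su] := boolP (code u \in s).
  by apply: memvZ; rewrite -[u]codeK; apply: mem_cspan_basis.
rewrite /hcoord -[dual u]codeK.
have -> : code (dual u) = codual (code u).
  have := decode_dual (code_lt u); rewrite codeK => ->.
  by rewrite decodeK ?codual_lt ?code_lt.
by rewrite x0 ?code_lt // mulr0 scale0r mem0v.
Qed.

Lemma dim_cspan s : uniq s -> all (ltn^~ 10) s -> \dim (cspan s) = size s.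
Proof.
elim: s => [|k s IHs] /=; first by rewrite /cspan span_nil dimv0.
case/andP=> sk us /andP[k10 s10]; rewrite -(IHs us s10).
rewrite {1}/cspan /= span_cons addvC dim_add_line //.
apply/negP=> /(cspanP _ s10)/(_ k k10 sk)/eqP.
by rewrite form_code_eq0 // eqxx.
Qed.

Lemma mul_code i j r : (i < 10)%N -> (j < 10)%N -> (r < 10)%N ->
  all (fun k => listed i j (codual k) == (k == r)) (iota 0 10) ->
  exists2 c, c != 0 & e i ** e j = c *: e r.
Proof.
move=> i10 j10 r10 /allP only.
have onlyE k : (k < 10)%N -> ('[e i ** e j, e (codual k)] == 0) = (k != r).
  by move=> k10; rewrite tri_code_eq0 ?codual_lt // (eqP (only _ _)) ?mem_iota.
have : e i ** e j \in cspan [:: r].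
  apply/cspanP => [|k k10]; first by rewrite /= r10.
  by rewrite inE -onlyE // => /eqP.
rewrite /cspan /= span_seq1 => /vlineP[c E]; exists c => //.
apply/eqP=> c0; have := onlyE r r10.
by rewrite E c0 scale0r form0l !eqxx.
Qed.

(** As [codual k] is the code of the basis vector paired with [e k], the condition
  [listed i j (codual k)] says that [e k] occurs in the product [e i ** e j]. *)
Definition product_in (S T R : seq nat) : bool :=
  all (fun i => all (fun j => all (fun k =>
    (k \in R) || ~~ listed i j (codual k)) (iota 0 10)) T) S.

Definition product_onto (S T R : seq nat) : bool :=
  all (fun r => has (fun i => has (fun j =>
    all (fun k => listed i j (codual k) == (k == r)) (iota 0 10)) T) S) R.

Lemma mulv_cspan_sub S T R : all (ltn^~ 10) (S ++ T ++ R) -> product_in S T R ->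
  (mulv (cspan S) (cspan T) <= cspan R)%VS.
Proof.
rewrite !all_cat => /and3P[S10 T10 R10] /allP inR; apply/mulvP=> x y Sx Ty.
have : (cspan T <= linfun (saa_mul L x) @^-1: cspan R)%VS.
  apply/span_subvP=> _ /mapP[j Tj ->]; rewrite -memv_preim lfunE /=.
  have : (cspan S <= linfun (saa_mul L (e j)) @^-1: cspan R)%VS.
    apply/span_subvP=> _ /mapP[i Si ->]; rewrite -memv_preim lfunE /=.
    rewrite mul_anti memvN; apply/cspanP=> // k k10 /negPf Rk.
    apply/eqP; rewrite tri_code_eq0 ?codual_lt ?(allP S10 _ Si : (i < 10)%N)
      ?(allP T10 _ Tj : (j < 10)%N) //.
    by have /allP/(_ j Tj)/allP/(_ k) := inR i Si; rewrite mem_iota Rk; apply.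
  by move/subvP/(_ x Sx); rewrite -memv_preim lfunE /= mul_anti memvN.
by move/subvP/(_ y Ty); rewrite -memv_preim lfunE.
Qed.

Lemma mulv_cspan S T R : all (ltn^~ 10) (S ++ T ++ R) ->
  product_in S T R && product_onto S T R ->
  mulv (cspan S) (cspan T) = cspan R.
Proof.
move=> STR10 /andP[inR /allP ontoR]; apply/eqP; rewrite eqEsubv mulv_cspan_sub //.
move: STR10; rewrite !all_cat => /and3P[S10 T10 R10].
apply/span_subvP=> _ /mapP[r Rr ->].
have /hasP[i Si /hasP[j Tj only]] := ontoR r Rr.
have [||||c nzc E] := @mul_code i j r;
  rewrite ?(allP S10 _ Si : (i < 10)%N) ?(allP T10 _ Tj : (j < 10)%N)
    ?(allP R10 _ Rr : (r < 10)%N) //.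
by rewrite -[e r](scalerK nzc) -E memvZ // memv_mulv ?mem_cspan_basis.
Qed.

Lemma orth_cspan S : all (ltn^~ 10) S ->
  orth (cspan S) = cspan [seq k <- iota 0 10 | codual k \notin S].
Proof.
move=> /allP S10; set T := [seq _ <- _ | _].
have T10 : all (ltn^~ 10) T.
  by apply/allP=> k; rewrite mem_filter mem_iota => /andP[_].
apply/vspaceP=> x; apply/idP/cspanP => // [/orthP Sx k k10 | Tx].
  have ki : k \in iota 0 10 by rewrite mem_iota.
  rewrite /T mem_filter ki andbT negbK => Sk; apply: Sx.
  exact: mem_cspan_basis.
have : (cspan S <= orth <[x]>)%VS.
  apply/span_subvP=> _ /mapP[k Sk ->]; apply/orthP=> _ /vlineP[c ->].
  have k10 : (k < 10)%N := S10 k Sk.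
  rewrite form_anti formE -[k]codualK // Tx ?mulr0 ?oppr0 ?codual_lt //.
  by rewrite /T mem_filter codualK // Sk.
move=> /subvP sub; apply/orthP=> y /sub/orthP/(_ x (memv_line x)) yx.
by rewrite form_anti yx oppr0.
Qed.

Lemma cspan_full : fullv = cspan (iota 0 10).
Proof.
by apply/vspaceP=> x; rewrite memvf; apply/esym/cspanP=> // k k10; rewrite mem_iota k10.
Qed.

Lemma lcs_cspan : [/\ lcs L 2 = cspan (iota 0 7), lcs L 3 = cspan (iota 0 6),
  lcs L 4 = cspan (iota 1 4), lcs L 5 = cspan [:: 3; 4]%N & lcs L 6 = cspan [::]].
Proof.
have E2 : lcs L 2 = cspan (iota 0 7).
  by rewrite lcsS [lcs L 1]cspan_full cspan_full; apply: mulv_cspan.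
have E3 : lcs L 3 = cspan (iota 0 6).
  by rewrite lcsS E2 cspan_full; apply: mulv_cspan.
have E4 : lcs L 4 = cspan (iota 1 4).
  by rewrite lcsS E3 cspan_full; apply: mulv_cspan.
have E5 : lcs L 5 = cspan [:: 3; 4]%N.
  by rewrite lcsS E4 cspan_full; apply: mulv_cspan.
by split=> //; rewrite lcsS E5 cspan_full; apply: mulv_cspan.
Qed.

Lemma mulL3L2_cspan : mulv (lcs L 3) (lcs L 2) = cspan [:: 2; 4]%N.
Proof. by have [-> -> _ _ _] := lcs_cspan; apply: mulv_cspan. Qed.

Lemma Usub_cspan : Usub L = cspan (iota 0 5).
Proof.
have [E2 E3 _ E5 _] := lcs_cspan; apply/vspaceP=> x.
rewrite mem_transporter mulL3L2_cspan E2 E3 E5.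
apply/andP/idP => [[L3x /mulvP xL2]|Ux].
  apply/cspanP => // k k10 k5.
  have [k6|k6] := boolP (k \in iota 0 6); last exact: (cspanP x _ L3x).
  have -> : k = 5%N by move: k5 k6; rewrite !mem_iota; lia.
  (* y_2 y_3 is a nonzero multiple of x_1, and (y_2 y_3, x) = (x y_2, y_3) vanishes
     because x y_2 has no component along x_3. *)
  have [//|//|//|//|c nzc E] := @mul_code 6 7 0.
  have : x ** e 6 \in cspan [:: 3; 4]%N.
    have := xL2 x (e 6) (memv_line x) (mem_cspan_basis (isT : 6 \in iota 0 7)%N).
    by rewrite memv_cap => /andP[].
  move/cspanP => /(_ isT 2 isT isT)%N; rewrite -[codual 2]/7%N tri_rot E formE.
  by move/eqP; rewrite mulf_eq0 (negPf nzc) /= form_anti oppr_eq0 => /eqP.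
have sub (S : seq nat) : product_in (iota 0 5) (iota 0 7) S -> all (ltn^~ 10) S ->
    (mulv <[x]> (cspan (iota 0 7)) <= cspan S)%VS.
  move=> inS S10; apply/mulvP=> _ y /vlineP[c ->] L2y; rewrite mulE memvZ //.
  have : (mulv (cspan (iota 0 5)) (cspan (iota 0 7)) <= cspan S)%VS by exact: mulv_cspan_sub.
  by move/subvP; apply; apply: memv_mulv.
split; last by rewrite subv_cap !sub.
by apply/cspanP=> // k k10 k6; apply: (cspanP x _ Ux) => //; move: k6; rewrite !mem_iota; lia.
Qed.

Lemma presented_invariants : has_invariants_10_3_5 L.
Proof.
have [E2 E3 E4 E5 E6] := lcs_cspan; split.
- by exists 6%N; rewrite E6 /cspan span_nil.
- exact: dim_standard std_b.
- have dimZ : \dim (center L) = 3%N by rewrite /center ucsE E2 orth_cspan // dim_cspan.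
  split=> // x y; rewrite /center ucsE E2 => Zx /orthP Ly.
  rewrite form_anti Ly ?oppr0 //; move: Zx; rewrite orth_cspan //.
  by apply: subvP; apply: sub_span; apply: sub_map; apply/allP.
split.
- by rewrite E3 dim_cspan.
- rewrite mulL3L2_cspan E5 => E.
  have /cspanP : e 2 \in cspan [:: 3; 4]%N by rewrite -E mem_cspan_basis.
  by move/(_ isT 2 isT isT)%N/eqP; rewrite form_code_eq0.
rewrite Usub_cspan ucsE E5 orth_cspan //.
have -> : mulv (cspan (iota 0 5)) (cspan [seq k <- iota 0 10 | codual k \notin [:: 3; 4]])%N
   = cspan [:: 3; 4]%N by apply: mulv_cspan.
by rewrite dim_cspan.
Qed.

End Invariants.

(** * Frames *)

(** Representatives of a basis of L / Z adapted to the flag L^2 > L^3 > Z_2 > Z: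
  x_1, y_1 span L^3 over Z_2, while y_3 spans the radical of the alternating form
  (x_2 _, _) on L / L^2.  The conditions on x_1 y_2 and y_1 y_2 say that y_3, y_4,
  y_5 are dual to y_1 y_2, a further central vector, and x_1 y_2. *)
Record frame (F : fieldType) (L : saa F) (x1 x2 y1 y2 y3 y4 y5 : L) : Prop := Frame {
  fr_x1 : x1 \in lcs L 3;
  fr_y1 : y1 \in lcs L 3;
  fr_x2 : x2 \in ucs L 2;
  fr_y2 : y2 \in lcs L 2;
  fr_xy1 : '[x1, y1] = 1;
  fr_xy2 : '[x2, y2] = 1;
  fr_x1y2 : '[x1, y2] = 0;
  fr_y1y2 : '[y1, y2] = 0;
  fr_x2y3 : x2 ** y3 = 0;
  fr_x245 : '[x2 ** y4, y5] = 1;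
  fr_x123 : '[x1 ** y2, y3] = 0;
  fr_x124 : '[x1 ** y2, y4] = 0;
  fr_x125 : '[x1 ** y2, y5] = 1;
  fr_y123 : '[y1 ** y2, y3] = 1;
  fr_y124 : '[y1 ** y2, y4] = 0;
  fr_y125 : '[y1 ** y2, y5] = 0
}.


(** Together with [frame_kill], these values are all the coordinates of the
  trilinear form on L / Z. *)
Record normal_frame (F : fieldType) (L : saa F) (x1 x2 y1 y2 y3 y4 y5 : L) : Prop :=
  NormalFrame {
  nf_frame : frame x1 x2 y1 y2 y3 y4 y5;
  nf_x134 : '[x1 ** y3, y4] = 1;
  nf_x135 : '[x1 ** y3, y5] = 0;
  nf_x145 : '[x1 ** y4, y5] = 0;
  nf_y134 : '[y1 ** y3, y4] = 0;
  nf_y135 : '[y1 ** y3, y5] = 0;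
  nf_y145 : '[y1 ** y4, y5] = 0;
  nf_y234 : '[y2 ** y3, y4] = 0;
  nf_y235 : '[y2 ** y3, y5] = 0;
  nf_y245 : '[y2 ** y4, y5] = 0;
  nf_y345 : '[y3 ** y4, y5] = 0
}.


(** The trilinear form does not see central summands, so a basis of L^2 + <y_3, y_4,
  y_5> modulo Z can be corrected inside Z until it is standard: adding central
  vectors to x_1, x_2, y_1, y_2 makes them orthogonal to y_3, y_4, y_5, and adding
  central vectors to y_4 and y_5 makes y_3, y_4, y_5 isotropic. *)
Lemma presented_mod_center (F : fieldType) (L : saa F) (Z D : {vspace L})
    (x1 x2 y1 y2 y3 y4 y5 : L) :
  \dim {:L} = 10%N ->
  (forall z v, z \in Z -> z ** v = 0) -> (forall z w, z \in Z -> w \in D -> '[z, w] = 0) ->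
  (Z <= D)%VS -> x1 \in D -> x2 \in D -> y1 \in D -> y2 \in D ->
  y1 ** y2 \in Z -> y5 ** x2 \in Z -> x1 ** y2 \in Z ->
  [/\ '[x1, x2] = 0, '[y1, x2] = 0, '[x1, y1] = 1 & '[x2, y2] = 1] ->
  '[x1, y2] = 0 -> '[y1, y2] = 0 ->
  [/\ x1 ** y1 = 0, x2 ** x1 = 0, x2 ** y1 = 0, x2 ** y2 = 0 & x2 ** y3 = 0] ->
  '[x2 ** y4, y5] = 1 ->
  [/\ '[x1 ** y2, y3] = 0, '[x1 ** y2, y4] = 0 & '[x1 ** y2, y5] = 1] ->
  [/\ '[x1 ** y3, y4] = 1, '[x1 ** y3, y5] = 0 & '[x1 ** y4, y5] = 0] ->
  [/\ '[y1 ** y2, y3] = 1, '[y1 ** y2, y4] = 0 & '[y1 ** y2, y5] = 0] ->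
  [/\ '[y1 ** y3, y4] = 0, '[y1 ** y3, y5] = 0 & '[y1 ** y4, y5] = 0] ->
  [/\ '[y2 ** y3, y4] = 0, '[y2 ** y3, y5] = 0, '[y2 ** y4, y5] = 0 &
      '[y3 ** y4, y5] = 0] ->
  presented L P_10_3_5.
Proof.
move=> dimL ZL0 ZD0 ZD Dx1 Dx2 Dy1 Dy2 Zx3 Zx4 Zx5.
move=> [x1x2 y1x2 x1y1 x2y2] x1y2 y1y2 [kx1y1 kx2x1 kx2y1 kx2y2 kx2y3] x245.
move=> [x123 x124 x125] [x134 x135 x145] [y123 y124 y125] [y134 y135 y145].
move=> [y234 y235 y245 y345].
set x3 := y1 ** y2 in Zx3; set x4 := y5 ** x2 in Zx4; set x5 := x1 ** y2 in Zx5.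
pose corr v := '[y3, v] *: x3 + '[y4, v] *: x4 + '[y5, v] *: x5.
have Zcorr v : corr v \in Z by rewrite !memvD ?memvZ.
pose o := nth 0 [:: x1; x2; 0; 0; 0; y1; y2; y3; y4; y5].
pose z := nth 0 [:: corr x1; corr x2; x3; x4; x5; corr y1; corr y2; 0;
                    '[y3, y4] *: x3; '[y3, y5] *: x3 + '[y4, y5] *: x4].
have Zz k : z k \in Z.
  rewrite /z; do 10?[case: k => [|k] /=]; rewrite ?nth_nil ?mem0v //.
  - by rewrite memvZ.
  by rewrite memvD ?memvZ.
pose e k := o k + z k.
have tri_e i j k : '[e i ** e j, e k] = '[o i ** o j, o k].
  have kill u v w : u \in Z -> ('[u ** v, w] = 0) * ('[v ** u, w] = 0) * ('[v ** w, u] = 0).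
    move=> Zu; have E : '[u ** v, w] = 0 by rewrite ZL0 // form0l.
    by rewrite !(tri_perms E) oppr0.
  by rewrite /e !(mulE, formE) !(kill _ _ _ (Zz _)) ?addr0.
have anti2 (u v : L) : '[u, v] = 0 -> ('[u, v] = 0) * ('[v, u] = 0).
  by move=> uv; rewrite (form_anti v) uv oppr0.
have Zform u : u \in Z -> ('[u, x1] = 0) * ('[x1, u] = 0) * ('[u, x2] = 0) * ('[x2, u] = 0) *
    ('[u, y1] = 0) * ('[y1, u] = 0) * ('[u, y2] = 0) * ('[y2, u] = 0).
  move=> Zu; have K w (Dw : w \in D) := anti2 _ _ (ZD0 u w Zu Dw).
  by rewrite !(K _ Dx1, K _ Dx2, K _ Dy1, K _ Dy2).
have ZZ u v : u \in Z -> v \in Z -> '[u, v] = 0.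
  by move=> Zu /(subvP ZD); apply: ZD0.
have xD := (Zform _ Zx3, Zform _ Zx4, Zform _ Zx5).
have xx := (anti2 _ _ (ZZ _ _ Zx3 Zx4), anti2 _ _ (ZZ _ _ Zx3 Zx5),
  anti2 _ _ (ZZ _ _ Zx4 Zx5), @saa_form_alt F L).
have x43 : '[x4, y3] = 0 by rewrite /x4 (tri_kill kx2y3).
have x44 : '[x4, y4] = 1 by rewrite /x4 (tri_perms x245).
have x45 : '[x4, y5] = 0 by rewrite /x4 tri_xyx.
have pair (v w : L) c : '[v, w] = c -> ('[v, w] = c) * ('[w, v] = - c).
  by move=> <-; rewrite (form_anti w).
have x3y := (pair x3 _ _ y123, pair x3 _ _ y124, pair x3 _ _ y125).
have x4y := (pair _ _ _ x43, pair _ _ _ x44, pair _ _ _ x45).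
have x5y := (pair x5 _ _ x123, pair x5 _ _ x124, pair x5 _ _ x125).
have yD y := (form_anti y x1, form_anti y x2, form_anti y y1, form_anti y y2).
have yy := (form_anti y4 y3, form_anti y5 y3, form_anti y5 y4).
have fx := (anti2 _ _ x1x2, anti2 _ _ y1x2, anti2 _ _ x1y2, anti2 _ _ y1y2,
  pair _ _ _ x1y1, pair _ _ _ x2y2).
apply: (@presented_codes _ _ e) => //.
- move=> i j i5 j5; rewrite /e.
  by do 5?[case: i i5 => [|i] // i5]; do 5?[case: j j5 => [|j] // j5];
    split; rewrite /o /z /= /corr !formE ?xD ?xx ?x3y ?x4y ?x5y ?fx ?yD ?yy; ring.
- have kill := (tri_kill kx1y1, tri_kill kx2x1, tri_kill kx2y1, tri_kill kx2y2,
    tri_kill kx2y3, @saa_mul0l F L, @saa_mul0r F L, @form0l F L, @form0r F L).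
  move=> i j k /andP[ij jk] k10; rewrite tri_e /o.
  by do 10?[case: k jk k10 => [|k] // jk k10]; do 9?[case: j ij jk => [|j] // ij jk];
    do 8?[case: i ij => [|i] // ij] => // _; rewrite /= ?kill.
by rewrite /= !tri_e /= x125 x134 x245 y123 !eqxx.
Qed.

(** * Structure forced by the invariants *)

Section Structure.
Variables (F : fieldType) (L : saa F).
Hypotheses (nilL : nilpotent L) (dimL : \dim {:L} = 10%N)
  (isoZ : isotropic (center L)) (dimZ : \dim (center L) = 3%N)
  (dimL3 : \dim (lcs L 3) = 6%N).

Local Notation L2 := (lcs L 2).
Local Notation L3 := (lcs L 3).
Local Notation Z := (center L).
Local Notation Z2 := (ucs L 2).

Lemma mem_lcsS k x v : x \in lcs L k.+1 -> x ** v \in lcs L k.+2.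
Proof. by move=> Lx; rewrite lcsS memv_mulv ?memvf. Qed.

Lemma lcs_decr k : (lcs L k.+2 <= lcs L k.+1)%VS.
Proof.
elim: k => [|k IHk]; first exact: subvf.
by apply/mulvP=> x y Lx _; apply: mem_lcsS; apply: (subvP IHk).
Qed.

Lemma ZE : Z = orth L2. Proof. exact: ucsE. Qed.
Lemma Z2E : Z2 = orth L3. Proof. exact: ucsE. Qed.

Lemma dimL2 : \dim L2 = 7%N.
Proof. by have := dim_orth L2; rewrite -ZE dimZ dimL addnC => -[]. Qed.

Lemma dimZ2 : \dim Z2 = 4%N.
Proof. by have := dim_orth L3; rewrite -Z2E dimL3 dimL => -[]. Qed.

Lemma form_ZL2 z w : z \in Z -> w \in L2 -> '[z, w] = 0.
Proof. by rewrite ZE => /orthP; apply. Qed.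

Lemma form_Z2L3 z w : z \in Z2 -> w \in L3 -> '[z, w] = 0.
Proof. by rewrite Z2E => /orthP; apply. Qed.

Lemma mulZ_eq0 z v : z \in Z -> z ** v = 0.
Proof.
rewrite ZE => /orthP z0; apply: saa_form_nondeg => w.
by rewrite tri_rot form_anti z0 ?oppr0 // mem_lcsS ?memvf.
Qed.

Lemma subZL2 : (Z <= L2)%VS.
Proof.
rewrite -(orthK L2) -ZE; apply/subvP=> x Zx; apply/orthP=> y; exact: isoZ.
Qed.

(** If a central t lay outside L^3, then L^2 = L^3 + <t>, so that L^3 = L^3 L,
  which nilpotency forbids. *)
Lemma subZL3 : (Z <= L3)%VS.
Proof.
apply: contraT => /subvPn[t Zt L3t].
have E : L2 = (L3 + <[t]>)%VS.
  by apply: eq_add_line; rewrite ?lcs_decr ?(subvP subZL2) ?dimL2 ?dimL3.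
have : (L3 <= 0)%VS; last by move/dimvS; rewrite dimL3 dimv0.
apply: nilpotent_sub => //.
  by apply/mulvP=> x y; rewrite memv0 => /eqP->; rewrite saa_mul0l mem0v.
rewrite addv0 {1}lcsS; apply/mulvP=> x y; rewrite E => /mem_add_line[w L3w [c ->]] _.
by rewrite !mulE (mulZ_eq0 _ Zt) scaler0 addr0 memv_mulv ?memvf.
Qed.

Lemma subZZ2 : (Z <= Z2)%VS.
Proof. by rewrite ZE Z2E orthS ?lcs_decr. Qed.

Lemma subZ2L2 : (Z2 <= L2)%VS.
Proof. by rewrite Z2E -(orthK L2) -ZE orthS ?subZL3. Qed.

Lemma Z2_line t : t \in Z2 -> t \notin Z -> Z2 = (Z + <[t]>)%VS.
Proof. by move=> *; apply: eq_add_line; rewrite ?subZZ2 ?dimZ2 ?dimZ. Qed.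

(** Z_2 is isotropic, being spanned by one vector over Z, which is orthogonal to
  L^2 >= Z_2; hence Z_2 lies in its own orthogonal L^3. *)
Lemma subZ2L3 : (Z2 <= L3)%VS.
Proof.
rewrite -(orthK L3) -Z2E; apply/subvP=> z Z2z; apply/orthP=> w Z2w.
have [Zz|Zz] := boolP (z \in Z); first by rewrite form_ZL2 ?(subvP subZ2L2).
move: Z2w; rewrite (Z2_line Z2z Zz) => /mem_add_line[u Zu [c ->]].
by rewrite !formE saa_form_alt mulr0 addr0 form_anti form_ZL2 ?oppr0 ?(subvP subZ2L2).
Qed.

Lemma mulZ2L2 z w : z \in Z2 -> w \in L2 -> z ** w = 0.
Proof.
move=> Z2z L2w; apply: saa_form_nondeg => v.
by rewrite tri_rot form_anti form_Z2L3 ?oppr0 ?mem_lcsS.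
Qed.

Lemma mulL2Z2 z w : z \in Z2 -> w \in L2 -> w ** z = 0.
Proof. by move=> *; rewrite mul_anti mulZ2L2 ?oppr0. Qed.

Lemma mulZ2Z z v : z \in Z2 -> z ** v \in Z.
Proof.
move=> Z2z; rewrite ZE; apply/orthP=> w L2w.
by rewrite tri_swap23 mulZ2L2 // formE oppr0.
Qed.

Lemma L3_plane x y : x \in L3 -> y \in L3 -> '[x, y] = 1 ->
  L3 = (Z2 + <[x]> + <[y]>)%VS.
Proof.
move=> L3x L3y xy.
have Z2x : x \notin Z2.
  by apply: contra_eqN xy => Z2x; rewrite form_Z2L3 // eq_sym oner_eq0.
have sub : (Z2 + <[x]> <= L3)%VS by rewrite subv_add subZ2L3 -memvE.
apply: eq_add_line => //; last by rewrite dim_add_line // dimZ2 dimL3.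
apply: contra_eqN xy => /mem_add_line[u Z2u [c ->]].
rewrite !formE saa_form_alt mulr0 addr0 form_anti form_Z2L3 // oppr0.
by rewrite eq_sym oner_eq0.
Qed.

Lemma L3_pair x : x \in L3 -> x \notin Z2 -> exists2 y, y \in L3 & '[x, y] = 1.
Proof. by rewrite Z2E => L3x; apply: not_orth. Qed.

(** On the symplectic plane L^3 / Z_2 every v acts by an endomorphism for which
  (xv, y) is alternating in x and y; such an endomorphism is a scalar, hence 0
  by nilpotency. *)
Lemma mul_L3_pair x y : x \in L3 -> y \in L3 -> '[x, y] = 1 -> x ** y = 0.
Proof.
move=> L3x L3y xy; apply: saa_form_nondeg => v; apply/eqP; apply: contraT => nz.
set c := '[x ** y, v] in nz.
have Z2xv : x ** v + c *: x \in Z2.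
  rewrite Z2E; apply/orthP=> w; rewrite (L3_plane L3x L3y xy).
  case/mem_add_line=> u /mem_add_line[z Z2z [k ->]] [k' ->].
  rewrite !formE xy saa_form_alt.
  rewrite (tri_swap23 x v y) -/c tri_xyx (form_anti x z) (form_Z2L3 Z2z L3x).
  have -> : '[x ** v, z] = 0; last by ring.
  by rewrite tri_swap23 mulL2Z2 ?formE ?oppr0 ?(subvP (lcs_decr 1)).
have : (<[x]> + Z2 <= Z2)%VS.
  apply: nilpotent_sub => //.
    by apply/mulvP=> z w Z2z _; rewrite (subvP subZZ2) ?mulZ2Z.
  rewrite subv_add addvSr andbT -memvE.
  have Ex : x = c^-1 *: - (x ** v) + c^-1 *: (x ** v + c *: x).
    by rewrite -scalerDr addrA addNr add0r scalerA mulVf // scale1r.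
  rewrite {1}Ex; apply: memv_add; last exact: memvZ.
  apply: memvZ; rewrite memvN memv_mulv ?memvf //.
  by rewrite (subvP (addvSl _ _)) ?memv_line.
rewrite subv_add -memvE => /andP[Z2x _].
by move: xy; rewrite form_Z2L3 // => /esym/eqP; rewrite oner_eq0.
Qed.

Lemma mulL3L3 x y : x \in L3 -> y \in L3 -> x ** y = 0.
Proof.
have [/subvP sub|/subvPn[u L3u Z2u]] := boolP (L3 <= Z2)%VS.
  by move=> /sub Z2x L3y; rewrite mulZ2L2 // (subvP (lcs_decr 1)).
have [t L3t ut] := L3_pair L3u Z2u; have ut0 := mul_L3_pair L3u L3t ut.
have tu0 : t ** u = 0 by rewrite mul_anti ut0 oppr0.
have L3L2 := subvP (lcs_decr 1); have Z2L3 := subvP subZ2L3.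
rewrite (L3_plane L3u L3t ut).
case/mem_add_line=> a /mem_add_line[z Z2z [k ->]] [k' ->].
case/mem_add_line=> b /mem_add_line[z' Z2z' [c ->]] [c' ->].
rewrite !mulE ut0 tu0 !saa_mul_alt !(mulZ2L2 Z2z) ?(mulL2Z2 Z2z') ?L3L2 // ?Z2L3 //.
by rewrite !scaler0 !addr0.
Qed.

Lemma lcs4_sub : (lcs L 4 <= Z2)%VS.
Proof.
apply/mulvP=> x v L3x _; rewrite Z2E; apply/orthP=> y L3y.
by rewrite tri_swap23 mulL3L3 // formE oppr0.
Qed.

Lemma Z2_pair x : x \in Z2 -> x \notin Z -> exists2 y, y \in L2 & '[x, y] = 1.
Proof. by rewrite ZE => Z2x; apply: not_orth. Qed.

Lemma L2_line x y : x \in Z2 -> y \in L2 -> '[x, y] = 1 -> L2 = (L3 + <[y]>)%VS.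
Proof.
move=> Z2x L2y xy; apply: eq_add_line; rewrite ?lcs_decr ?dimL3 ?dimL2 //.
by apply: contra_eqN xy => L3y; rewrite form_Z2L3 // eq_sym oner_eq0.
Qed.

Lemma mulL3L2Z x w : x \in L3 -> w \in L2 -> x ** w \in Z.
Proof.
move=> L3x L2w; rewrite ZE; apply/orthP=> v L2v.
have /subvPn[t Z2t Zt] : ~~ (Z2 <= Z)%VS.
  by apply: contraTN isT => /dimvS; rewrite dimZ dimZ2.
have [y L2y ty] := Z2_pair Z2t Zt.
move: L2w L2v; rewrite (L2_line Z2t L2y ty).
case/mem_add_line=> a L3a [k ->] /mem_add_line[b L3b [c ->]].
rewrite mulE mulL3L3 // add0r mulE !formE tri_xyy !mulr0 addr0.
by rewrite tri_swap23 mulL3L3 // formE oppr0 mulr0.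
Qed.

Lemma not_central x : x \notin Z -> exists v w, '[x ** v, w] = 1.
Proof.
move=> Zx; have /subvPn[v _ xv] : ~~ (fullv <= lker (linfun (saa_mul L x)))%VS.
  apply: contra Zx => /subvP x0; rewrite mem_transporter memvf /=.
  apply/mulvP=> _ v /vlineP[k ->] /x0; rewrite memv_ker lfunE /= => /eqP xv.
  by rewrite mulE xv scaler0 mem0v.
suff /not_orth[w _ xvw] : x ** v \notin orth fullv by exists v, w.
move: xv; rewrite memv_ker lfunE /=; apply: contra => /orthP xv0.
by apply/eqP/saa_form_nondeg=> w; rewrite xv0 ?memvf.
Qed.

Lemma mul_Z2L2_form x w v : x \in Z2 -> w \in L2 -> '[x ** v, w] = 0.
Proof. by move=> Z2x L2w; rewrite tri_swap23 mulZ2L2 // formE oppr0. Qed.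

Lemma dim_L2_plane x v w : x \in Z2 -> '[x ** v, w] = 1 ->
  \dim (L2 + <[v]> + <[w]>) = 9%N.
Proof.
move=> Z2x xvw; have Z2Lx := mul_Z2L2_form _ Z2x.
rewrite !dim_add_line ?dimL2 //.
  apply: contra_eqN xvw => /Z2Lx xw.
  by rewrite tri_swap23 xw oppr0 eq_sym oner_eq0.
apply: contra_eqN xvw => /mem_add_line[l /Z2Lx L2l [k ->]].
by rewrite formE L2l formE tri_xyy mulr0 addr0 eq_sym oner_eq0.
Qed.

Lemma L_span x y3 y4 y5 : x \in Z2 -> x ** y3 = 0 -> y3 \notin L2 ->
  '[x ** y4, y5] = 1 -> fullv = (L2 + <[y4]> + <[y5]> + <[y3]>)%VS.
Proof.
move=> Z2x xy3 L2y3 x45; have Z2Lx := mul_Z2L2_form _ Z2x.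
have x54 : '[x ** y5, y4] = -1 by rewrite tri_swap23 x45.
apply: eq_add_line; rewrite ?subvf ?memvf ?(dim_L2_plane Z2x x45) ?dimL //.
apply: contra L2y3 => /mem_add_line[m /mem_add_line[l L2l [b ->]] [c E]].
have := congr1 (saa_mul L x) E; rewrite xy3 !mulE mulZ2L2 // add0r => E0.
have b0 : b = 0.
  by have := congr1 (fun u => '[u, y5]) E0; rewrite !formE x45 tri_xyy; move=> ->; ring.
have c0 : c = 0.
  have := congr1 (fun u => '[u, y4]) E0; rewrite !formE x54 tri_xyy b0.
  by rewrite mul0r add0r mulrN1 => /esym/eqP; rewrite oppr_eq0 => /eqP.
by rewrite E b0 c0 !scale0r !addr0.
Qed.

Lemma L_frame x : x \in Z2 -> x \notin Z -> exists y3 y4 y5,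
  [/\ x ** y3 = 0, y3 \notin L2 & '[x ** y4, y5] = 1].
Proof.
move=> Z2x /not_central[v [w xvw]].
have xwv : '[x ** w, v] = -1 by rewrite tri_swap23 xvw.
have Z2Lx := mul_Z2L2_form _ Z2x.
pose A := (L2 + <[v]> + <[w]>)%VS.
have /subvPn[t _ At] : ~~ (fullv <= A)%VS.
  by apply/negP=> /dimvS; rewrite dimL (dim_L2_plane Z2x xvw).
(* An alternating form on a space of odd dimension 3 has a nonzero radical: this y
   is orthogonal to v and w for the form (x _, _) on L / L^2. *)
pose y := t - '[x ** v, t] *: w - '[x ** t, w] *: v.
have Ey : t = y + '[x ** t, w] *: v + '[x ** v, t] *: w.
  by rewrite /y !subrK.
have xyw : '[x ** y, w] = 0 by rewrite /y !mulE !formE xvw tri_xyy; ring.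
have xyv : '[x ** y, v] = 0.
  by rewrite /y !mulE !formE xwv tri_xyy (tri_swap23 x t v); ring.
clearbody y.
have L2y : y \notin L2.
  apply: contra At => L2y; rewrite Ey /A.
  by rewrite !(memv_add, memvZ, memv_line).
have AE : fullv = (A + <[t]>)%VS.
  by apply: eq_add_line; rewrite ?subvf ?memvf // (dim_L2_plane Z2x xvw) dimL.
exists y, v, w; split=> //; apply: saa_form_nondeg => u.
have : u \in fullv by exact: memvf.
rewrite AE => /mem_add_line[_ /mem_add_line[_ /mem_add_line[l L2l [a ->]] [b ->]] [c ->]].
rewrite !formE Z2Lx // xyv xyw Ey !formE xyv xyw tri_xyy; ring.
Qed.

Hypotheses (neqL : mulv (lcs L 3) (lcs L 2) <> lcs L 5)
  (dimUZ : \dim (mulv (Usub L) (ucs L 4)) = 2%N).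

Lemma lcs5_sub : (lcs L 5 <= Z)%VS.
Proof. by apply/mulvP=> x v /(subvP lcs4_sub) Z2x _; apply: mulZ2Z. Qed.

(** If L^4 were central then L^5 = 0, and L^3 L^2 = 0 because
  (L^3 L^2, L) = (L^4, L^2). *)
Lemma lcs4_nsub : ~~ (lcs L 4 <= Z)%VS.
Proof.
apply/negP=> /subvP L4Z; apply: neqL; rewrite [RHS]lcsS.
have zero (A B : {vspace L}) :
    (forall x y, x \in A -> y \in B -> x ** y = 0) -> mulv A B = 0%VS.
  move=> AB0; apply/eqP; rewrite -subv0; apply/mulvP=> x y Ax By.
  by rewrite AB0 ?mem0v.
rewrite (zero L3) ?zero // => x y Ax By; first by rewrite mulZ_eq0 ?L4Z.
apply: saa_form_nondeg => v.
by rewrite tri_swap23 form_ZL2 ?oppr0 // L4Z ?mem_lcsS.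
Qed.

(** L^3 = L^2 L is spanned by products (u + ky)v with u in L^3.  Such a product is
  orthogonal to w, because (uv, w) is up to sign (uw, v), and uw = 0, while (yv, w)
  = (wy, v). *)
Lemma mul_L3y_eq0 x y w : x \in Z2 -> y \in L2 -> '[x, y] = 1 ->
  w \in L3 -> w ** y = 0 -> w \in Z2.
Proof.
move=> Z2x L2y xy L3w wy; rewrite Z2E -[w]opprK memvN.
have : (L3 <= orth <[w]>)%VS; last first.
  move=> /subvP sub; apply/orthP=> u /sub/orthP/(_ w (memv_line w)).
  by rewrite !formE form_anti => /eqP; rewrite oppr_eq0 => /eqP->; rewrite oppr0.
rewrite [lcs L 3]lcsS; apply/mulvP=> m v; rewrite (L2_line Z2x L2y xy).
case/mem_add_line=> u L3u [k ->] _; apply/orthP=> _ /vlineP[c ->].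
rewrite !mulE !formE (tri_swap23 u) mulL3L3 // formE.
by rewrite -(tri_rot w y v) wy formE; ring.
Qed.

(** L^5 = Z_2 L = xL is orthogonal to y_3, as xy_3 = 0, which leaves at most a plane
  of Z; on the other hand xy_4 and xy_5 are independent. *)
Lemma lcs5E x y3 y4 y5 : x \in lcs L 4 -> x ** y3 = 0 -> y3 \notin L2 ->
  '[x ** y4, y5] = 1 -> lcs L 5 = (Z :&: orth <[y3]>)%VS /\ \dim (lcs L 5) = 2%N.
Proof.
move=> L4x xy3 L2y3 x45; have Z2x := subvP lcs4_sub _ L4x.
have Zx : x \notin Z.
  by apply: contra_eqN x45 => Zx; rewrite mulZ_eq0 // formE eq_sym oner_eq0.
have sub : (lcs L 5 <= Z :&: orth <[y3]>)%VS.
  rewrite subv_cap lcs5_sub; apply/mulvP=> w v /(subvP lcs4_sub).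
  rewrite (Z2_line Z2x Zx) => /mem_add_line[z Zz [k ->]] _.
  apply/orthP=> _ /vlineP[c ->]; rewrite mulE mulZ_eq0 // add0r mulE !formE.
  by rewrite (tri_swap23 x) xy3 formE; ring.
have le2 : (\dim (Z :&: orth <[y3]>) <= 2)%N.
  rewrite -ltnS -dimZ; apply: contraR L2y3; rewrite -leqNgt => leZ.
  have /eqP E : (Z :&: orth <[y3]> == Z)%VS by rewrite eqEdim capvSl.
  rewrite -(orthK L2) -ZE -E; apply/orthP=> z; rewrite memv_cap.
  by case/andP=> _ /orthP/(_ y3 (memv_line _)) zy; rewrite form_anti zy oppr0.
have ge2 : (2 <= \dim (lcs L 5))%N.
  have: (<[x ** y4]> + <[x ** y5]> <= lcs L 5)%VS.
    by rewrite subv_add -!memvE !mem_lcsS.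
  move/dimvS; rewrite dim_add_line ?dim_vline.
    by case: eqP => // E; move: x45; rewrite E formE => /esym/eqP; rewrite oner_eq0.
  apply: contra_eqN x45 => /vlineP[k E]; rewrite tri_swap23 E formE tri_xyy.
  by rewrite mulr0 oppr0 eq_sym oner_eq0.
have E : lcs L 5 = (Z :&: orth <[y3]>)%VS.
  by apply/eqP; rewrite eqEdim sub (leq_trans le2).
by split=> //; apply/eqP; rewrite eqn_leq ge2 {1}E le2.
Qed.

Lemma mulL3L2E x y u t : x \in Z2 -> y \in L2 -> '[x, y] = 1 ->
  u \in L3 -> t \in L3 -> '[u, t] = 1 ->
  mulv L3 L2 = (<[u ** y]> + <[t ** y]>)%VS /\ \dim (mulv L3 L2) = 2%N.
Proof.
move=> Z2x L2y xy L3u L3t ut.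
have E : mulv L3 L2 = (<[u ** y]> + <[t ** y]>)%VS.
  apply/eqP; rewrite eqEsubv subv_add -!memvE !memv_mulv // !andbT.
  apply/mulvP=> a b L3a; rewrite (L2_line Z2x L2y xy) => /mem_add_line[m L3m [k ->]].
  rewrite mulE mulL3L3 // add0r mulE memvZ //.
  move: L3a; rewrite (L3_plane L3u L3t ut).
  case/mem_add_line=> _ /mem_add_line[z Z2z [c ->]] [d ->].
  rewrite !mulE mulZ2L2 // add0r.
  by apply: memv_add; apply: memvZ; apply: memv_line.
split=> //; rewrite E.
have tu : '[t, u] = -1 by rewrite form_anti ut.
rewrite dim_add_line ?dim_vline.
  case: eqP => // uy; have := mul_L3y_eq0 Z2x L2y xy L3u uy.
  by move=> Z2u; move: ut; rewrite form_Z2L3 // => /esym/eqP; rewrite oner_eq0.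
apply/negP=> /vlineP[k ty].
have /(mul_L3y_eq0 Z2x L2y xy) Z2w : t - k *: u \in L3 by rewrite rpredB ?memvZ.
have := form_Z2L3 (Z2w _) L3u; rewrite !mulE ty subrr => /(_ erefl).
rewrite !formE tu saa_form_alt mulr0 oppr0 addr0 => /eqP.
by rewrite oppr_eq0 oner_eq0.
Qed.

(** Taking x_2 in L^4 makes x_2 L equal to L^5.  The planes L^3 L^2 and L^5 of Z
  differ, so some m in L^3 satisfies (my, y_3) = 1, because L^5 is the
  orthogonal of y_3 in Z; this m serves as y_1, and adding a multiple of it to x_1
  achieves (x_1 y, y_3) = 0. *)
Lemma frame_exists : exists x1 x2 y1 y2 y3 y4 y5 : L, frame x1 x2 y1 y2 y3 y4 y5.
Proof.
have /subvPn[x2 L4x2 Zx2] := lcs4_nsub.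
have Z2x2 := subvP lcs4_sub _ L4x2; have [y L2y x2y] := Z2_pair Z2x2 Zx2.
have [y3 [v [w [x2y3 L2y3 xvw]]]] := L_frame Z2x2 Zx2.
have [L5E dimL5] := lcs5E L4x2 x2y3 L2y3 xvw.
have /subvPn[u L3u Z2u] : ~~ (L3 <= Z2)%VS.
  by apply: contraTN isT => /dimvS; rewrite dimL3 dimZ2.
have [t L3t ut] := L3_pair L3u Z2u.
have [L32E dimL32] := mulL3L2E Z2x2 L2y x2y L3u L3t ut.
have [m L3m my3] : exists2 m, m \in L3 & '[m ** y, y3] = 1.
  have /subvPn[f] : ~~ (mulv L3 L2 <= lcs L 5)%VS.
    by apply/negP=> sub; apply: neqL; apply/eqP; rewrite eqEdim sub dimL32 dimL5.
  rewrite L32E => /mem_add_line[_ /vlineP[c ->] [d ->]].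
  rewrite -!mulZl -mulDl; set e := _ + _; have L3e : e \in L3 by rewrite rpredD ?memvZ.
  rewrite L5E memv_cap mulL3L2Z //=; set a := '[e ** y, y3] => ney.
  have nz : a != 0.
    apply: contra ney => /eqP a0; apply/orthP=> _ /vlineP[k ->].
    by rewrite formE -/a a0 mulr0.
  by exists (a^-1 *: e); rewrite ?memvZ // mulE formE -/a mulVf.
have Z2m : m \notin Z2.
  apply/negP=> Z2m; have := my3; rewrite mulZ2L2 // formE => /esym/eqP.
  by rewrite oner_eq0.
have [p L3p mp] := L3_pair L3m Z2m.
pose x1 := '[p ** y, y3] *: m - p.
have L3x1 : x1 \in L3 by rewrite rpredB ?memvZ.
have x1m : '[x1, m] = 1 by rewrite /x1 !formE saa_form_alt (form_anti p) mp; ring.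
have x1y3 : '[x1 ** y, y3] = 0 by rewrite /x1 !mulE !formE my3; ring.
clearbody x1.
pose y2 := y - '[x1, y] *: m + '[m, y] *: x1.
have mx1 : '[m, x1] = -1 by rewrite form_anti x1m.
have E2 u' : u' \in L3 -> u' ** y2 = u' ** y.
  by move=> L3u'; rewrite /y2 !mulE (mulL3L3 L3u' L3m) (mulL3L3 L3u' L3x1) !scaler0 subr0 addr0.
have L2y2 : y2 \in L2.
  by rewrite /y2 rpredD ?rpredB ?memvZ // (subvP (lcs_decr 1)).
have x2y2 : '[x2, y2] = 1.
  by rewrite /y2 !formE x2y (form_Z2L3 Z2x2 L3m) (form_Z2L3 Z2x2 L3x1); ring.
have x1y2 : '[x1, y2] = 0 by rewrite /y2 !formE x1m saa_form_alt; ring.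
have my2 : '[m, y2] = 0 by rewrite /y2 !formE mx1 saa_form_alt; ring.
have x1y_nz : x1 ** y != 0.
  apply/eqP=> /(mul_L3y_eq0 Z2x2 L2y x2y L3x1) Z2x1.
  by move: x1m; rewrite form_Z2L3 // => /esym/eqP; rewrite oner_eq0.
(* A unimodular change of the pair v, w keeps (x_2 y_4, y_5) = 1. *)
have [y4 [y5 [x245 x124 x125]]] : exists y4 y5,
    [/\ '[x2 ** y4, y5] = 1, '[x1 ** y, y4] = 0 & '[x1 ** y, y5] = 1].
  have xwv : '[x2 ** w, v] = -1 by rewrite tri_swap23 xvw.
  have [w0|w0] := eqVneq '[x1 ** y, w] 0.
    have [v0|v0] := eqVneq '[x1 ** y, v] 0.
      case/eqP: x1y_nz; apply: saa_form_nondeg => q.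
      have : q \in fullv by exact: memvf.
      rewrite (L_span Z2x2 x2y3 L2y3 xvw).
      case/mem_add_line=> _ /mem_add_line[_ /mem_add_line[l L2l [a ->]] [b ->]] [c ->].
      by rewrite !formE v0 w0 x1y3 form_ZL2 ?mulL3L2Z //; ring.
    exists (- '[x1 ** y, v] *: w), ('[x1 ** y, v]^-1 *: v).
    by rewrite !mulE !formE xwv w0; split; field.
  exists ('[x1 ** y, w] *: v - '[x1 ** y, v] *: w), ('[x1 ** y, w]^-1 *: w).
  by rewrite !mulE !formE xvw tri_xyy; split; field.
exists x1, x2, m, y2, y3, (y4 - '[m ** y, y4] *: y3), (y5 - '[m ** y, y5] *: y3).
split=> //; rewrite ?E2 // !(mulE, formE) ?x2y3 ?(tri_swap23 x2 y4 y3) ?x2y3 ?formE;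
  rewrite ?x245 ?x124 ?x125 ?x1y3 ?my3 ?mul0r; ring.
Qed.

(** U lies in Z_2 + <x_1> and Z_4 in L^2 + <y_3>, so that x_1 y_2 and x_1 y_3 span
  U Z_4.  If (x_1 y_3, y_4) vanished, then x_1 y_3 would be a multiple of x_1 y_2,
  and U Z_4 would have dimension at most 1. *)
Lemma frame_x134 (x1 x2 y1 y2 y3 y4 y5 : L) : frame x1 x2 y1 y2 y3 y4 y5 ->
  '[x1 ** y3, y4] != 0.
Proof.
case=> L3x1 L3y1 Z2x2 L2y2 xy1 xy2 _ _ x2y3 x245 x123 x124 x125 y123 y124 y125.
have L2y3 : y3 \notin L2.
  apply: contra_eqN y123 => L2y3.
  by rewrite form_ZL2 ?mulL3L2Z // eq_sym oner_eq0.
have Zx2 : x2 \notin Z.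
  by apply: contra_eqN xy2 => Zx2; rewrite form_ZL2 // eq_sym oner_eq0.
have fullE := L_span Z2x2 x2y3 L2y3 x245.
have L5E : lcs L 5 = (Z :&: orth <[y3]>)%VS.
  have /subvPn[x L4x Zx] := lcs4_nsub.
  have := subvP lcs4_sub _ L4x; rewrite (Z2_line Z2x2 Zx2).
  case/mem_add_line=> z Zz [c Ex].
  have nzc : c != 0 by apply: contraNneq Zx => c0; rewrite Ex c0 scale0r addr0.
  have xE v : x ** v = c *: (x2 ** v) by rewrite Ex !mulE mulZ_eq0 // add0r.
  have [||||//] := @lcs5E x y3 y4 (c^-1 *: y5).
  - by [].
  - by rewrite xE x2y3 scaler0.
  - by [].
  by rewrite xE !formE x245; field.
apply/eqP=> x134.
have x1y3Z : x1 ** y3 \in Z.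
  rewrite ZE; apply/orthP=> w; rewrite (L2_line Z2x2 L2y2 xy2).
  case/mem_add_line=> u L3u [k ->]; rewrite formE tri_swap23 mulL3L3 // formE.
  by rewrite formE tri_swap23 x123; ring.
have x13 : x1 ** y3 = '[x1 ** y3, y5] *: (x1 ** y2).
  apply/eqP; rewrite -subr_eq0; apply/eqP/saa_form_nondeg => q.
  have : q \in fullv by exact: memvf.
  rewrite fullE; set d := _ - _.
  case/mem_add_line=> _ /mem_add_line[_ /mem_add_line[l L2l [a ->]] [b ->]] [c ->].
  have Zd : d \in Z by apply: memvB => //; apply: memvZ; apply: mulL3L2Z.
  by rewrite !(formDr, formZr) form_ZL2 // /d !formE x134 x124 x123 x125 tri_xyy; ring.
have : (mulv (Usub L) (ucs L 4) <= <[x1 ** y2]>)%VS; last first.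
  by move/dimvS; rewrite dimUZ dim_vline; case: (_ != 0).
apply/mulvP=> u v; rewrite mem_transporter => /andP[L3u /mulvP uL2].
have {uL2} : '[u ** y2, y3] = 0.
  have := uL2 u y2 (memv_line u) L2y2; rewrite memv_cap L5E => /andP[_].
  by rewrite memv_cap => /andP[_ /orthP]; apply; apply: memv_line.
move: L3u; rewrite (L3_plane L3x1 L3y1 xy1).
case/mem_add_line=> _ /mem_add_line[z Z2z [k ->]] [k' ->].
rewrite !mulE !formE x123 y123 mulZ2L2 // form0l mulr0 mulr1 !add0r => ->.
rewrite scale0r addr0 ucsE => /orthP v0.
have : v \in fullv by exact: memvf.
rewrite fullE.
case/mem_add_line=> _ /mem_add_line[_ /mem_add_line[l L2l [a ->]] [b ->]] [c Ev].
have x254 : '[x2 ** y5, y4] = -1 by rewrite tri_swap23 x245.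
have L5x2 w : x2 ** w \in lcs L 5.
  rewrite L5E memv_cap mulZ2Z //=; apply/orthP=> _ /vlineP[e ->].
  by rewrite formE tri_swap23 x2y3 formE oppr0 mulr0.
have b0 : b = 0.
  have := v0 _ (L5x2 y4); rewrite Ev form_anti !formE mul_Z2L2_form // tri_xyy x245.
  rewrite (tri_swap23 x2 y4 y3) x2y3 formE => /eqP.
  by rewrite !(mulr0, oppr0, addr0, add0r, mulr1) oppr_eq0 => /eqP.
have a0 : a = 0.
  have := v0 _ (L5x2 y5); rewrite Ev form_anti !formE mul_Z2L2_form // tri_xyy x254.
  by rewrite (tri_swap23 x2 y5 y3) x2y3 formE mulrN1 !(mulr0, oppr0, addr0, add0r) opprK.
rewrite Ev a0 b0 !scale0r !addr0.
move: Z2z; rewrite (Z2_line Z2x2 Zx2) => /mem_add_line[z0 Zz0 [m ->]].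
move: L2l; rewrite (L2_line Z2x2 L2y2 xy2) => /mem_add_line[l3 L3l [n ->]].
have L3L2 := subvP (lcs_decr 1).
rewrite !mulE !(mulZ_eq0 _ Zz0) (mulZ2L2 Z2x2 (L3L2 _ L3l)) (mulZ2L2 Z2x2 L2y2).
rewrite x2y3 (mulL3L3 L3x1 L3l) x13 !scaler0 !add0r.
by rewrite scalerA -scalerDl !memvZ ?memv_line.
Qed.

(** * Normalizing a frame *)

Lemma frame_kill (x1 x2 y1 y2 y3 y4 y5 : L) : frame x1 x2 y1 y2 y3 y4 y5 ->
  [/\ x1 ** y1 = 0, x2 ** x1 = 0, x2 ** y1 = 0 & x2 ** y2 = 0].
Proof.
case=> L3x1 L3y1 Z2x2 L2y2 _ _ _ _ _ _ _ _ _ _ _ _.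
by rewrite mulL3L3 // !mulZ2L2 // (subvP (lcs_decr 1)).
Qed.

(** The scaling exponents keep (x_2, y_2) and the three values of the trilinear form
  that are already 1, and divide (x_1 y_3, y_4) by its value a. *)
Lemma normalize1 (x1 x2 y1 y2 y3 y4 y5 : L) : frame x1 x2 y1 y2 y3 y4 y5 ->
  exists x2 y2 y3 y4 y5 : L, frame x1 x2 y1 y2 y3 y4 y5 /\ '[x1 ** y3, y4] = 1.
Proof.
move=> fr; have := frame_x134 fr; set a := '[_, y4] => nz.
case: fr => L3x1 L3y1 Z2x2 L2y2 xy1 xy2 x1y2 y1y2 x2y3 x245 x123 x124 x125 y123 y124 y125.
exists (a *: x2), (a^-1 *: y2), (a *: y3), (a^-2 *: y4), (a *: y5).
split; last by rewrite !mulE !formE -/a; field.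
by split; rewrite ?memvZ // !(mulE, formE) ?x2y3 ?scaler0 //
   ?(xy2, x1y2, y1y2, x245, x123, x124, x125, y123, y124, y125); field.
Qed.

(** As (y_1 y_2, y_3) = (x_1 y_2, y_5) = 1, adding multiples of y_2 to y_3, y_4, y_5
  shifts the coordinates (x_1 y_3, y_5), (y_1 y_3, y_4) and (y_1 y_3, y_5)
  independently. *)
Lemma normalize2 (x1 x2 y1 y2 y3 y4 y5 : L) :
  frame x1 x2 y1 y2 y3 y4 y5 -> '[x1 ** y3, y4] = 1 ->
  exists y3 y4 y5 : L, frame x1 x2 y1 y2 y3 y4 y5 /\
  [/\ '[x1 ** y3, y4] = 1, '[x1 ** y3, y5] = 0,
      '[y1 ** y3, y4] = 0 & '[y1 ** y3, y5] = 0].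
Proof.
move=> fr x134.
have [/tri_kill x1y1 /tri_kill x2x1 /tri_kill x2y1 /tri_kill x2y2] := frame_kill fr.
case: fr => L3x1 L3y1 Z2x2 L2y2 xy1 xy2 fx1y2 fy1y2 /tri_kill x2y3.
move=> /tri_perms x245 /tri_perms x123 /tri_perms x124 /tri_perms x125.
move=> /tri_perms y123 /tri_perms y124 /tri_perms y125.
exists (y3 - '[x1 ** y3, y5] *: y2), (y4 + '[y1 ** y3, y4] *: y2),
  (y5 + '[y1 ** y3, y5] *: y2).
pose zero := (x1y1, x2x1, x2y1, x2y2, x2y3, tri_alt).
by split; split=> //; rewrite !(mulE, formE) ?zero ?form0l
   ?(x245, x123, x124, x125, y123, y124, y125) ?x134 ?(scaler0, oppr0, addr0) //; ring.
Qed.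

(** The form (x_2 _, _) is the coordinate form of the pair y_4, y_5, so subtracting
  multiples of x_2 from x_1 and y_1 clears their coordinates on that pair; moving y_2
  by an element of L^3 restores orthogonality and is invisible to x_1 and y_1. *)
Lemma normalize3 (x1 x2 y1 y2 y3 y4 y5 : L) :
  frame x1 x2 y1 y2 y3 y4 y5 -> '[x1 ** y3, y4] = 1 -> '[x1 ** y3, y5] = 0 ->
  '[y1 ** y3, y4] = 0 -> '[y1 ** y3, y5] = 0 ->
  exists x1 y1 y2 : L, frame x1 x2 y1 y2 y3 y4 y5 /\
  [/\ '[x1 ** y3, y4] = 1, '[x1 ** y3, y5] = 0 & '[x1 ** y4, y5] = 0] /\
  [/\ '[y1 ** y3, y4] = 0, '[y1 ** y3, y5] = 0 & '[y1 ** y4, y5] = 0].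
Proof.
move=> fr x134 x135 y134 y135.
have [/tri_kill x1y1 /tri_kill x2x1 /tri_kill x2y1 /tri_kill x2y2] := frame_kill fr.
case: fr => L3x1 L3y1 Z2x2 L2y2 xy1 xy2 fx1y2 fy1y2 /tri_kill x2y3.
move=> /tri_perms x245 /tri_perms x123 /tri_perms x124 /tri_perms x125.
move=> /tri_perms y123 /tri_perms y124 /tri_perms y125.
have yx1 : '[y1, x1] = -1 by rewrite form_anti xy1.
have x2L3 w : w \in L3 -> ('[x2, w] = 0) * ('[w, x2] = 0).
  by move=> L3w; rewrite (form_anti w) form_Z2L3 // oppr0.
exists (x1 - '[x1 ** y4, y5] *: x2), (y1 - '[y1 ** y4, y5] *: x2),
  (y2 + '[x1 ** y4, y5] *: y1 - '[y1 ** y4, y5] *: x1).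
pose zero := (x1y1, x2x1, x2y1, x2y2, x2y3, tri_alt).
have L3x2 := subvP subZ2L3 _ Z2x2; have L32 := subvP (lcs_decr 1).
pose val := (x134, x135, y134, y135, xy1, xy2, fx1y2, fy1y2, yx1, @saa_form_alt F L,
  x2L3 _ L3x1, x2L3 _ L3y1).
by split; [split | split; split] => //;
  do ?[apply: memvB | apply: memvD | apply: memvZ] => //;
  rewrite ?L32 // ?(mulE, formE) ?zero ?form0l
   ?(x245, x123, x124, x125, y123, y124, y125) ?val ?(scaler0, oppr0, addr0) //; ring.
Qed.

(** By now (y_1 _, _) pairs only y_2 with y_3, and (x_2 _, _) only y_4 with y_5.
  Hence multiples of y_1 added to y_4, y_5 affect only the coordinates on the triples
  y_2, y_3, y_4 and y_2, y_3, y_5, and multiples of x_2 added to y_2, y_3 only those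
  on y_2, y_4, y_5 and y_3, y_4, y_5. *)
Lemma normalize4 (x1 x2 y1 y2 y3 y4 y5 : L) :
  frame x1 x2 y1 y2 y3 y4 y5 ->
  [/\ '[x1 ** y3, y4] = 1, '[x1 ** y3, y5] = 0 & '[x1 ** y4, y5] = 0] ->
  [/\ '[y1 ** y3, y4] = 0, '[y1 ** y3, y5] = 0 & '[y1 ** y4, y5] = 0] ->
  exists y2 y3 y4 y5 : L, normal_frame x1 x2 y1 y2 y3 y4 y5.
Proof.
move=> fr [/tri_perms x134 /tri_perms x135 /tri_perms x145].
move=> [/tri_perms y134 /tri_perms y135 /tri_perms y145].
have [/tri_kill x1y1 /tri_kill x2x1 /tri_kill x2y1 /tri_kill x2y2] := frame_kill fr.
case: fr => L3x1 L3y1 Z2x2 L2y2 xy1 xy2 fx1y2 fy1y2 /tri_kill x2y3.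
move=> /tri_perms x245 /tri_perms x123 /tri_perms x124 /tri_perms x125.
move=> /tri_perms y123 /tri_perms y124 /tri_perms y125.
exists (y2 - '[y2 ** y4, y5] *: x2), (y3 - '[y3 ** y4, y5] *: x2),
  (y4 - '[y2 ** y3, y4] *: y1), (y5 - '[y2 ** y3, y5] *: y1).
pose zero := (x1y1, x2x1, x2y1, x2y2, x2y3, tri_alt).
have L2x2 := subvP subZ2L2 _ Z2x2; have x2x2 := saa_mul_alt x2.
pose val := (x134, x135, x145, y134, y135, y145, xy1, xy2, fx1y2, fy1y2,
  @saa_form_alt F L, form_anti x1 x2, form_anti y1 x2,
  form_Z2L3 Z2x2 L3x1, form_Z2L3 Z2x2 L3y1).
by split; first split=> //; do ?[apply: memvB | apply: memvZ] => //;
  rewrite !(mulE, formE) ?zero ?form0l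
   ?(x245, x123, x124, x125, y123, y124, y125) ?val ?x2x2 ?(scaler0, oppr0, addr0) //; ring.
Qed.

Lemma normal_frame_exists :
  exists x1 x2 y1 y2 y3 y4 y5 : L, normal_frame x1 x2 y1 y2 y3 y4 y5.
Proof.
have [x1 [x2 [y1 [y2 [y3 [y4 [y5 fr]]]]]]] := frame_exists.
have {fr} [{}x2 [{}y2 [{}y3 [{}y4 [{}y5 [fr x134]]]]]] := normalize1 fr.
have {fr x134} [{}y3 [{}y4 [{}y5 [fr [x134 x135 y134 y135]]]]] := normalize2 fr x134.
have {fr x134 x135 y134 y135} [{}x1 [{}y1 [{}y2 [fr [Ex Ey]]]]] :=
  normalize3 fr x134 x135 y134 y135.
have {fr Ex Ey} [{}y2 [{}y3 [{}y4 [{}y5 nf]]]] := normalize4 fr Ex Ey.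
by exists x1, x2, y1, y2, y3, y4, y5.
Qed.

Lemma invariants_presented : presented L P_10_3_5.
Proof.
have [x1 [x2 [y1 [y2 [y3 [y4 [y5 nf]]]]]]] := normal_frame_exists.
case: nf => fr x134 x135 x145 y134 y135 y145 y234 y235 y245 y345.
have [x1y1 x2x1 x2y1 x2y2] := frame_kill fr.
case: fr => L3x1 L3y1 Z2x2 L2y2 fxy1 fxy2 fx1y2 fy1y2 x2y3 x245 x123 x124 x125 y123 y124 y125.
have L32 := subvP (lcs_decr 1).
apply: (@presented_mod_center F L Z L2 x1 x2 y1 y2 y3 y4 y5) => //; rewrite ?L32 //.
- by move=> z v; apply: mulZ_eq0.
- by move=> z w; apply: form_ZL2.
- exact: subZL2.
- exact: (subvP subZ2L3).
- exact: mulL3L2Z.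
- by rewrite mul_anti memvN mulZ2Z.
- exact: mulL3L2Z.
by split=> //; rewrite form_anti form_Z2L3 ?oppr0.
Qed.

End Structure.


(** * The algebra of a presentation *)

Section Model.
Variables (F : fieldType) (n : nat).
Local Notation label := ('I_n + 'I_n)%type.
Local Notation V := 'rV[F]_(n + n).
Variable P : seq (label * label * label).
Implicit Types (u v w : label) (x y z : V).

Definition mcoord u x : F := x 0 (unsplit u).
Definition mbasis u : V := delta_mx 0 (unsplit u).

Lemma mcoord_lin u k x y : mcoord u (k *: x + y) = k * mcoord u x + mcoord u y.
Proof. by rewrite /mcoord !mxE. Qed.

Lemma mcoord_basis u v : mcoord u (mbasis v) = (u == v)%:R.
Proof. by rewrite /mcoord mxE eqxx (can_eq unsplitK). Qed.

Definition mform x y : F := \sum_u dual_sign F u * (mcoord u x * mcoord (dual u) y).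

Definition det3 (t : label * label * label) x y z : F :=
  let: (p, q, r) := t in
  mcoord p x * (mcoord q y * mcoord r z - mcoord r y * mcoord q z)
  - mcoord q x * (mcoord p y * mcoord r z - mcoord r y * mcoord p z)
  + mcoord r x * (mcoord p y * mcoord q z - mcoord q y * mcoord p z).

(** The alternating form x_p^* /\ x_q^* /\ x_r^* summed over the listed triples. *)
Definition mtri x y z : F := \sum_(t <- P) det3 t x y z.

(** The vector that represents the functional [mtri x y] under [mform]. *)
Definition mmul x y : V :=
  \row_k (dual_sign F (split k) * mtri x y (mbasis (dual (split k)))).

Fact mform_bilinear : bilinear_for *%R *%R mform.
Proof.
split=> [y | x] k a b /=; rewrite /mform mulr_sumr -big_split; apply: eq_bigr => u _;
  by rewrite mcoord_lin /=; ring.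
Qed.

HB.instance Definition _ := bilinear_isBilinear.Build F V V F
  (GRing.Scale.Law.clone _ _ *%R _) (GRing.Scale.Law.clone _ _ *%R _)
  mform mform_bilinear.

Lemma mtri_linl k x x' y z : mtri (k *: x + x') y z = k * mtri x y z + mtri x' y z.
Proof.
rewrite /mtri mulr_sumr -big_split; apply: eq_bigr => -[[p q] r] _.
by rewrite /= !mcoord_lin; ring.
Qed.

Lemma mtri_rot x y z : mtri x y z = mtri y z x.
Proof. by apply: eq_bigr => -[[p q] r] _; rewrite /=; ring. Qed.

Lemma mtri_alt x z : mtri x x z = 0.
Proof. by rewrite /mtri big1 // => -[[p q] r] _; rewrite /=; ring. Qed.

Fact mmul_bilinear : bilinear_for *:%R *:%R mmul.
Proof.
split=> [y | x] k a b; apply/rowP=> j; rewrite !mxE; first by rewrite mtri_linl; ring.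
by rewrite !(mtri_rot x) mtri_linl; ring.
Qed.

HB.instance Definition _ := bilinear_isBilinear.Build F V V V
  (GRing.Scale.Law.clone _ _ *:%R _) (GRing.Scale.Law.clone _ _ *:%R _)
  mmul mmul_bilinear.

(** Antisymmetry would not suffice in characteristic 2; the halves of the sum over
  the x_i and over the y_i cancel termwise. *)
Lemma mform_alt x : mform x x = 0.
Proof.
rewrite /mform big_sumType /= -big_split big1 // => i _ /=; ring.
Qed.

Lemma mform_basis x u : mform x (mbasis (dual u)) = dual_sign F u * mcoord u x.
Proof.
rewrite /mform (bigD1 u) //= mcoord_basis eqxx mulr1 big1 ?addr0 // => v /negPf vu.
by rewrite mcoord_basis (can_eq (@dualK n)) vu !mulr0.
Qed.

Lemma mform_nondeg x : (forall y, mform x y = 0) -> x = 0.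
Proof.
move=> x0; apply/rowP=> k; rewrite mxE -[k]splitK -[LHS]/(mcoord (split k) x).
have := mform_basis x (split k); rewrite x0 => /esym E.
by rewrite -[LHS]mul1r -(dual_signK F (split k)) -mulrA E mulr0.
Qed.

Lemma mtri_expand x y z : mtri x y z = \sum_u mcoord u z * mtri x y (mbasis u).
Proof.
have lin k a b : mtri x y (k *: a + b) = k * mtri x y a + mtri x y b.
  by rewrite -!(mtri_rot _ x) mtri_linl.
have {1}-> : z = \sum_u mcoord u z *: mbasis u.
  apply/rowP=> k; rewrite summxE -[k]splitK (bigD1 (split k)) //= mxE -/(mcoord _ _).
  rewrite -/(mcoord _ (mbasis _)) mcoord_basis eqxx mulr1 big1 ?addr0 // => u /negPf uk.
  by rewrite mxE -/(mcoord _ (mbasis _)) mcoord_basis eq_sym uk mulr0.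
elim/big_rec2: _ => [|u c v _ <-]; last by rewrite lin.
by rewrite /mtri big1 // => -[[p q] r] _; rewrite /= /mcoord !mxE; ring.
Qed.

Lemma mform_mul x y z : mform (mmul x y) z = mtri x y z.
Proof.
rewrite mtri_expand [RHS](reindex (@dual n)) /=; last exact: onW_bij (inv_bij (@dualK n)).
apply: eq_bigr => u _; rewrite {1}/mcoord mxE unsplitK.
by rewrite -!mulrA mulrA dual_signK mul1r mulrC.
Qed.

Lemma mmul_alt x : mmul x x = 0.
Proof. by apply/rowP=> k; rewrite !mxE mtri_alt mulr0. Qed.

Lemma mmul_cyclic x y z : mform (mmul x y) z = mform (mmul y z) x.
Proof. by rewrite !mform_mul mtri_rot. Qed.

Definition model : saa F :=
  @SAA F V mform mmul mform_alt mform_nondeg mmul_alt mmul_cyclic.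

(* A listed triple with a repeated entry would contribute 0, and a triple listed
   twice, up to order, would have its contributions added. *)
Hypotheses (uniqP : uniq P)
  (distinct : forall p q r, (p, q, r) \in P -> uniq [:: p; q; r])
  (once : forall s t, s \in P -> t \in P ->
    perm_eq [:: s.1.1; s.1.2; s.2] [:: t.1.1; t.1.2; t.2] -> s = t).

(** Each of the six terms of the determinant is a product of three Kronecker symbols
  that match the two triples in some order. *)
Lemma det3_basis0 u v w p q r : ~~ perm_eq [:: u; v; w] [:: p; q; r] ->
  det3 (p, q, r) (mbasis u) (mbasis v) (mbasis w) = 0.
Proof.
move=> nperm; have term a b c : perm_eq [:: a; b; c] [:: p; q; r] ->
    (a == u)%:R * ((b == v)%:R * (c == w)%:R) = 0 :> F.
  move=> abc; case: (a =P u) => [au|]; last by rewrite mul0r.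
  case: (b =P v) => [bv|]; last by rewrite mul0r mulr0.
  case: (c =P w) => [cw|]; last by rewrite !mulr0.
  by case/negP: nperm; rewrite -au -bv -cw.
rewrite /= !mcoord_basis !mulrBr !term ?subrr ?addr0 //.
- by rewrite (perm_catCA [:: r] [:: q] [:: p]) (perm_catC [:: q; r] [:: p]).
- by rewrite (perm_catC [:: r] [:: p; q]).
- by rewrite (perm_catC [:: q; r] [:: p]).
- by rewrite (perm_catCA [:: q] [:: p] [:: r]).
by rewrite perm_cons (perm_catC [:: r] [:: q]).
Qed.

Lemma model_presented : presented model P.
Proof.
exists mbasis; split.
- apply: hyperbolic_standard; last by rewrite dimvf /dim /= mul1n.
  have form_basis u v : mform (mbasis u) (mbasis v) = (dual v == u)%:R * dual_sign F (dual v).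
    by rewrite -[v in LHS]dualK mform_basis mcoord_basis mulrC.
  split=> i j; rewrite [LHS]form_basis /= ?mul0r ?mulr1 //.
  by rewrite eq_sym.
- move=> u v w Pt; rewrite [LHS]mform_mul /mtri (bigD1_seq (u, v, w)) //=.
  have := distinct Pt; rewrite /= !inE negb_or => /and3P[/andP[uv uw] vw _].
  rewrite !mcoord_basis !eqxx (eq_sym v u) (eq_sym w u) (eq_sym w v).
  rewrite (negPf uv) (negPf uw) (negPf vw) big_seq_cond big1; first by rewrite /=; ring.
  move=> [[p q] r] /andP[Pt' ne]; apply: det3_basis0; apply: contra ne => E.
  by apply/eqP; apply: once => //; rewrite perm_sym.
move=> u v w nP; rewrite [LHS]mform_mul /mtri big_seq big1 // => -[[p q] r] Pt.
by apply: det3_basis0; apply: contra nP => E; apply/hasP; exists (p, q, r).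
Qed.

End Model.

(** * Existence and uniqueness *)

Lemma uniq_P_10_3_5 : uniq P_10_3_5.
Proof.
by apply: (@map_uniq _ _ (fun t => [:: code t.1.1; code t.1.2; code t.2]));
  rewrite code_P_10_3_5.
Qed.

Lemma code_mem_P_10_3_5 t : t \in P_10_3_5 ->
  map code [:: t.1.1; t.1.2; t.2] \in code_triples.
Proof.
by move=> /(map_f (fun t => [:: code t.1.1; code t.1.2; code t.2])); rewrite code_P_10_3_5.
Qed.

Lemma distinct_P_10_3_5 p q r : (p, q, r) \in P_10_3_5 -> uniq [:: p; q; r].
Proof.
move=> /code_mem_P_10_3_5 Pt; apply: (@map_uniq _ _ code).
by apply: (allP _ _ Pt).
Qed.

Lemma once_P_10_3_5 s t : s \in P_10_3_5 -> t \in P_10_3_5 ->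
  perm_eq [:: s.1.1; s.1.2; s.2] [:: t.1.1; t.1.2; t.2] -> s = t.
Proof.
move=> /code_mem_P_10_3_5 Ps /code_mem_P_10_3_5 Pt /(perm_map code) E.
have /allrelP/(_ _ _ Ps Pt) : all2rel (fun a b => perm_eq a b ==> (a == b)) code_triples by [].
rewrite E => /eqP/(inj_map (can_inj codeK)).
by case: s t {Ps Pt E} => [[? ?] ?] [[? ?] ?] [-> -> ->].
Qed.

Theorem proposition4p9 (F : fieldType) :
  exists L : saa F, [/\ has_invariants_10_3_5 L, presented L P_10_3_5 &
    forall L' : saa F, has_invariants_10_3_5 L' -> isomorphic L' L].
Proof.
have presL : presented (model F P_10_3_5) P_10_3_5.
  by apply: model_presented;
    [exact: uniq_P_10_3_5 | exact: distinct_P_10_3_5 | exact: once_P_10_3_5].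
exists (model F P_10_3_5); split=> //.
  by case: presL => b [sb one zero]; apply: (presented_invariants sb one zero).
move=> L' [nilL dimL [isoZ dimZ] [dimL3 neqL dimUZ]].
by apply: presented_isomorphic presL; apply: invariants_presented.
Qed.
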